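(* Let $d\ge1$. Let $0<a<1$ be an irrational number and suppose that there exist $\delta>0$ and $\gamma\ge 2$ such that $|a-h/k|\ge\delta k^{-\gamma}$ for every rational $h/k$ ($h\in\mathbb{Z}$, $k\in\mathbb{N}$, $k\geq 1$). Then there exists a constant $c>0$, depending (explicitly) only on $\delta,\gamma,d$, with the following property. If $A=[-a/2,a/2]^d$, if $\Omega$ is a bounded Borel set in $\mathbb{R}^d$, if $\mu$ is a $\mathbb{Z}^d$-periodic (complex) Borel measure on $\mathbb{R}^d$, finite on $\mathbb{T}^d$, and if $f$ is a $\mathbb{Z}^d$-periodic smooth function on $\mathbb{R}^d$, then $$\left|\int_\Omega f(x)\,\overline{d\mu(x)}\right|\le c\left\{\int_{\mathbb{T}^d}\left|\sum_{n\in\mathbb{Z}^d}\mu\big((x+n-A)\cap\Omega\big)\right|^2dx\right\}^{1/2}\left\{\sum_{n\in\mathbb{Z}^d}\left(\prod_{k=1}^d(1+|n_k|)^{2\gamma}\right)\left|\widehat f(n)\right|^2\right\}^{1/2}.$$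
   Context: $\mathbb{T}^d=\mathbb{R}^d/\mathbb{Z}^d=[0,1)^d$; functions and finite measures on $\mathbb{T}^d$ are identified with $\mathbb{Z}^d$-periodic ones on $\mathbb{R}^d$. $\widehat f(n)=\int_{\mathbb{T}^d}f(x)e^{-2\pi i n\cdot x}dx$ for $n=(n_1,\dots,n_d)\in\mathbb{Z}^d$. $x+n-A=\{x+n-y:y\in A\}$. $\overline{d\mu}$ is the complex conjugate measure. *)

(* Defs.v *)
From HB Require Import structures.
From mathcomp Require Import all_boot all_order all_algebra.
From mathcomp Require Import all_classical all_reals all_analysis.
From mathcomp Require Import measurable_realfun complex.

Set Implicit Arguments.
Unset Strict Implicit.
Unset Printing Implicit Defensive.

Import Order.TTheory GRing.Theory Num.Theory.
Import numFieldNormedType.Exports.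

Local Open Scope classical_set_scope.
Local Open Scope ring_scope.
Local Open Scope complex_scope.

(* The sup-norm topology of 'rV[R]_d is the usual one of R^d, so the sigma-algebra
   below is the Borel one. *)
Definition borel_rV_display : measure_display. Proof. exact. Qed.

HB.instance Definition _ (R : realType) (d : nat) :=
  @isMeasurable.Build borel_rV_display 'rV[R]_d
    <<s @open 'rV[R]_d >>
    (@sigma_algebra0 _ setT _) (@sigma_algebraC _ _) (@sigma_algebra_bigcup _ setT _).

Section borel_rV.
Context {R : realType}.

Lemma open_measurable_rV d (U : set 'rV[R]_d) : open U -> measurable U.
Proof. exact: sub_sigma_algebra. Qed.

Lemma measurable_coord d (i : 'I_d) :
  measurable_fun [set: 'rV[R]_d] (fun x : 'rV[R]_d => x ord0 i).
Proof.
apply: (measurability _ (RGenOpens.measurableE R)).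
move=> _ [_ [x [y ->]] <-]; rewrite setTI; apply: open_measurable_rV.
apply: open_comp; last exact: interval_open.
by move=> v _; exact: coord_continuous.
Qed.

Lemma measurable_fun_rV dT (T : measurableType dT) d (f : T -> 'rV[R]_d) :
  (forall i, measurable_fun [set: T] (fun t => f t ord0 i)) ->
  measurable_fun [set: T] f.
Proof.
move=> mf; apply: (measurability (@open 'rV[R]_d)) => //.
move=> _ [U oU <-]; rewrite setTI.
pose box (qk : {ffun 'I_d -> rat} * nat) := [set v : 'rV[R]_d |
  forall i, ball (ratr (qk.1 i) : R) qk.2.+1%:R^-1 (v ord0 i)].
have mbox qk : measurable (f @^-1` box qk).
  rewrite [X in measurable X](_ : _ = \bigcap_(i in [set: 'I_d])
    (setT `&` (fun t => f t ord0 i) @^-1` ball (ratr (qk.1 i) : R) qk.2.+1%:R^-1)).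
    apply: fin_bigcap_measurable => [|i _]; first exact: finite_finset.
    by apply: mf => //; apply: open_measurable; exact: ball_open.
  apply/seteqP; split => [t /= h i|t /= h i]; first by move=> _; split => //; exact: h.
  by have [] := h i Logic.I.
have -> : U = \bigcup_(qk in [set qk | box qk `<=` U]) box qk.
  apply/seteqP; split=> [v Uv|v [qk /= qkU qkv]]; last exact: qkU.
  have /nbhs_ballP[e /= e0 eU] : nbhs v U by exact: open_nbhs_nbhs.
  have [k ke] : exists k : nat, k.+1%:R^-1 < e / 2.
    have /ltr_add_invr[k] : 0 < e / 2 by rewrite divr_gt0.
    by rewrite add0r => ?; exists k.
  have k0 : 0 < k.+1%:R^-1 :> R by rewrite invr_gt0 ltr0n.
  have rq i : exists q : rat, ball (v ord0 i) k.+1%:R^-1 (ratr q : R).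
    have [] := @dense_rat R (ball (v ord0 i) k.+1%:R^-1).
    - by exists (v ord0 i); exact: ballxx.
    - exact: ball_open.
    - by move=> x [vx [q _ qx]]; exists q; rewrite qx.
  have [q qP] := boolp.choice rq.
  exists ([ffun i => q i], k); last first.
    by move=> i; rewrite /= ffunE; apply: ball_sym; exact: qP.
  move=> w /= bw; apply: eU; split => // i j; rewrite (ord1 i).
  have /= := bw j; rewrite ffunE => qw.
  apply: (@le_ball _ _ _ (k.+1%:R^-1 + k.+1%:R^-1)).
    by rewrite [e]splitr lerD// ltW.
  by apply: ball_triangle (qw); exact: qP.
rewrite preimage_bigcup bigcup_mkcond.
apply: countable_bigcupT_measurable => // qk.
by case: ifP => // _; exact: mbox.
Qed.

End borel_rV.

Section lebesgue_rV.
Context {R : realType}.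

Definition consrV d (p : R * 'rV[R]_d) : 'rV[R]_d.+1 :=
  row_mx (p.1)%:M p.2 : 'rV[R]_(1 + d).

Definition unconsrV d (v : 'rV[R]_d.+1) : R * 'rV[R]_d :=
  (v ord0 ord0, @rsubmx _ 1 1 d v).

Lemma unconsrVK d : cancel (@unconsrV d) (@consrV d).
Proof.
move=> v; transitivity (@row_mx R 1 1 d (@lsubmx _ 1 1 d v) (@rsubmx _ 1 1 d v)).
  rewrite /consrV /unconsrV /=; congr (@row_mx _ 1 1 d _ _).
  apply/matrixP => i j; rewrite !ord1 !mxE eqxx mulr1n.
  by congr (v _ _); apply/val_inj.
exact: (@hsubmxK _ 1 1 d v).
Qed.

Lemma consrV0 d (p : R * 'rV[R]_d) : consrV p ord0 ord0 = p.1.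
Proof.
transitivity (row_mx ((p.1)%:M : 'M[R]_1) p.2 ord0 (lshift d ord0)).
  by congr (row_mx _ _ _ _); apply/val_inj.
by rewrite row_mxEl mxE eqxx mulr1n.
Qed.

Lemma consrVS d (p : R * 'rV[R]_d) j : consrV p ord0 (lift ord0 j) = p.2 ord0 j.
Proof.
transitivity (row_mx ((p.1)%:M : 'M[R]_1) p.2 ord0 (rshift 1 j)).
  by congr (row_mx _ _ _ _); apply/val_inj.
by rewrite row_mxEr.
Qed.

Lemma consrVK d : cancel (@consrV d) (@unconsrV d).
Proof.
move=> [x v]; rewrite /unconsrV consrV0; congr pair.
exact: (@row_mxKr _ 1 1 d).
Qed.

Lemma measurable_consrV d : measurable_fun setT (@consrV d).
Proof.
apply: measurable_fun_rV => i; case: (unliftP ord0 i) => [j|] ->.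
  rewrite (_ : (fun _ => _) = (fun v : 'rV[R]_d => v ord0 j) \o snd).
    by apply: measurableT_comp => //; exact: measurable_coord.
  by apply/funext => p /=; rewrite consrVS.
by rewrite (_ : (fun _ => _) = fst)//; apply/funext => p; rewrite consrV0.
Qed.

Lemma measurable_unconsrV d : measurable_fun setT (@unconsrV d).
Proof.
apply/measurable_fun_pairP; split => /=; first exact: measurable_coord.
apply: measurable_fun_rV => i /=.
rewrite (_ : (fun _ => _) = (fun v : 'rV[R]_d.+1 => v ord0 (rshift 1 i))).
  exact: measurable_coord.
by apply/funext => v /=; rewrite mxE.
Qed.

Definition lebesgueS d (m : {sigma_finite_measure set 'rV[R]_d -> \bar R}) :
    set 'rV[R]_d.+1 -> \bar R :=
  pushforward (lebesgue_measure \x m)%E (@consrV d).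

Section lebesgueS.
Variables (d : nat) (m : {sigma_finite_measure set 'rV[R]_d -> \bar R}).

Let lebesgueS0 : lebesgueS m set0 = 0%E.
Proof. by rewrite /lebesgueS /pushforward preimage_set0 measure0. Qed.

Let lebesgueS_ge0 A : (0 <= lebesgueS m A)%E.
Proof. exact: (measure_ge0 (lebesgue_measure \x m)%E). Qed.

Let lebesgueS_sigma_additive : semi_sigma_additive (lebesgueS m).
Proof.
pose p := measure_function_pushforward__canonical__measure_function_Measure
  (lebesgue_measure \x m)%E (@measurable_consrV d).
exact: (@measure_semi_sigma_additive _ _ _ p).
Qed.

HB.instance Definition _ := isMeasure.Build _ _ _ (lebesgueS m)
  lebesgueS0 lebesgueS_ge0 lebesgueS_sigma_additive.

Let lebesgueS_sigma_finite : sigma_finite setT (lebesgueS m).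
Proof.
have /sigma_finiteP[F [TF ndF Foo]] := sigma_finiteT (@lebesgue_measure R).
have /sigma_finiteP[G [TG ndG Goo]] := sigma_finiteT m.
exists (fun n => @unconsrV d @^-1` (F n `*` G n)).
  apply/seteqP; split => // v _.
  have [n _ Fn] : (\bigcup_i F i) (unconsrV v).1 by rewrite -TF.
  have [k _ Gk] : (\bigcup_i G i) (unconsrV v).2 by rewrite -TG.
  exists (maxn n k) => //; split.
    by move: Fn; exact/subsetPset/ndF/leq_maxl.
  by move: Gk; exact/subsetPset/ndG/leq_maxr.
move=> k; have [mF Fk] := Foo k; have [mG Gk] := Goo k.
have mFG : measurable (F k `*` G k) by exact: measurableX.
split; first by rewrite -[X in measurable X]setTI; exact: measurable_unconsrV.
rewrite /lebesgueS /pushforward -comp_preimage.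
rewrite (_ : _ \o _ = id); last by apply/funext => p /=; rewrite consrVK.
by rewrite preimage_id product_measure1E// lte_mul_pinfty// ge0_fin_numE.
Qed.

HB.instance Definition _ := Measure_isSigmaFinite.Build _ _ _ (lebesgueS m)
  lebesgueS_sigma_finite.

End lebesgueS.

Fixpoint lebesgue_rV d : {sigma_finite_measure set 'rV[R]_d -> \bar R} :=
  match d return {sigma_finite_measure set 'rV[R]_d -> \bar R} with
  | 0%N => \d_(0 : 'rV[R]_0)
  | e.+1 => lebesgueS (lebesgue_rV e)
  end.

End lebesgue_rV.

Section torus.
Context {R : realType} {d : nat}.

Definition zrV (n : 'rV[int]_d) : 'rV[R]_d := map_mx intr n.

Definition Zperiodic (T : Type) (f : 'rV[R]_d -> T) :=
  forall (x : 'rV[R]_d) (n : 'rV[int]_d), f (x + zrV n) = f x.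

Definition unit_cube : set 'rV[R]_d := [set x | forall i, 0 <= x ord0 i < 1].

Definition box (a : R) : set 'rV[R]_d :=
  [set y | forall i, - (a / 2) <= y ord0 i <= a / 2].

Definition partials (s : seq 'I_d) (g : 'rV[R]_d -> R) : 'rV[R]_d -> R :=
  foldr (fun i h x => 'D_(delta_mx ord0 i) h x) g s.

(* C^oo: all iterated partial derivatives exist and are continuous. *)
Definition smooth (g : 'rV[R]_d -> R) := forall s : seq 'I_d,
  continuous (partials s g) /\
  forall (i : 'I_d) (x : 'rV[R]_d), derivable (partials s g) x (delta_mx ord0 i).

Definition csmooth (f : 'rV[R]_d -> R[i]) :=
  smooth (fun x => complex.Re (f x)) /\ smooth (fun x => complex.Im (f x)).

Definition expi (t : R) : R[i] := cos t +i* sin t.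

Definition cintegral (m : {measure set 'rV[R]_d -> \bar R}) (D : set 'rV[R]_d)
    (f : 'rV[R]_d -> R[i]) : R[i] :=
  (\int[m]_(x in D) complex.Re (f x)) +i* (\int[m]_(x in D) complex.Im (f x)).

Definition fourier_coef (f : 'rV[R]_d -> R[i]) (n : 'rV[int]_d) : R[i] :=
  cintegral (lebesgue_rV d) unit_cube
    (fun x => f x * expi (- (2 * pi * \sum_(i < d) (n ord0 i)%:~R * x ord0 i))).

End torus.

Section cmeasure.
Context {R : realType} {d : nat}.

Definition locally_sigma_additive (nu : set 'rV[R]_d -> R) :=
  forall F : (set 'rV[R]_d)^nat, (forall k, measurable (F k)) ->
    trivIset setT F -> bounded_set (\bigcup_k F k) ->
    (fun n => \sum_(0 <= k < n) nu (F k)) @ \oo --> nu (\bigcup_k F k).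

(* A complex measure on R^d that is finite on bounded sets only, such as a
   nonzero periodic one, has no value on unbounded sets: only the values on
   bounded Borel sets are meaningful. Countable additivity of a C-valued set
   function gives finite total variation on each bounded Borel set. *)
Record cmeasure := CMeasure {
  cmeasure_fun :> set 'rV[R]_d -> R[i] ;
  cmeasure_Re : locally_sigma_additive (fun E => complex.Re (cmeasure_fun E)) ;
  cmeasure_Im : locally_sigma_additive (fun E => complex.Im (cmeasure_fun E)) }.

Definition Zperiodic_cmeasure (mu : cmeasure) :=
  forall (E : set 'rV[R]_d) (n : 'rV[int]_d), measurable E -> bounded_set E ->
    mu [set x + zrV n | x in E] = mu E.

Lemma conj_cmeasure_Im (mu : cmeasure) :
  locally_sigma_additive (fun E => complex.Im (mu E)^*).
Proof.
have ImE E : complex.Im (mu E)^* = - complex.Im (mu E) by case: (mu E).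
move=> F mF tF bF; rewrite ImE (_ : (fun _ => _) = - (fun n : nat => \sum_(0 <= k < n) complex.Im (mu (F k)))).
  by apply: cvgN; exact: cmeasure_Im.
by apply/funext => n; rewrite fctE -sumrN; apply: eq_bigr => k _; rewrite ImE.
Qed.

Lemma conj_cmeasure_Re (mu : cmeasure) :
  locally_sigma_additive (fun E => complex.Re (mu E)^*).
Proof.
have ReE E : complex.Re (mu E)^* = complex.Re (mu E) by case: (mu E).
move=> F mF tF bF; rewrite ReE.
rewrite (_ : (fun _ => _) = fun n : nat => \sum_(0 <= k < n) complex.Re (mu (F k))).
  exact: cmeasure_Re.
by apply/funext => n; apply: eq_bigr => k _; rewrite ReE.
Qed.

Definition conj_cmeasure (mu : cmeasure) : cmeasure :=
  CMeasure (@conj_cmeasure_Re mu) (@conj_cmeasure_Im mu).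

Section restriction.
Variables (nu : set 'rV[R]_d -> R) (nuD : locally_sigma_additive nu).
Variables (W : set 'rV[R]_d) (mW : measurable W) (bW : bounded_set W).

(* The proofs are phantom arguments that let the charge structure be inferred. *)
Definition restr_charge & locally_sigma_additive nu & measurable W
  & bounded_set W : set 'rV[R]_d -> \bar R := fun E => (nu (E `&` W))%:E.

Local Notation rnu := (restr_charge nuD mW bW).

Lemma bounded_sub (A B : set 'rV[R]_d) :
  A `<=` B -> bounded_set B -> bounded_set A.
Proof.
move=> AB [M [Mr MB]]; exists M; split => // x Mx y Ay.
by apply: (MB x Mx); exact: AB.
Qed.

Let rnu0 : rnu set0 = 0%E.
Proof.
pose c := nu set0; pose u : R^nat := fun n => \sum_(0 <= k < n) c.
have uc : u @ \oo --> c.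
  have := @nuD (fun=> set0) (fun=> measurable0).
  rewrite bigcup0// => /(_ (@trivIset_set0 _ _ _)); apply.
  by apply: bounded_sub bW.
have uS : (fun n => u n.+1) @ \oo --> c + c.
  rewrite (_ : (fun _ => _) = (fun n => u n + c)).
    by apply: cvgD => //; exact: cvg_cst.
  by apply/funext => n; rewrite /u big_nat_recr.
have uS' : (fun n => u n.+1) @ \oo --> c by rewrite cvg_shiftS.
have c0 : c = 0.
  by apply: (addrI c); rewrite addr0; exact: (cvg_unique _ uS uS').
by rewrite /restr_charge set0I -/c c0.
Qed.

Let rnu_fin A : measurable A -> rnu A \is a fin_num.
Proof. by []. Qed.

Let rnu_sigma_additive : semi_sigma_additive rnu.
Proof.
move=> F mF tF mUF; rewrite /restr_charge.
rewrite setI_bigcupl; under eq_fun do rewrite sumEFin.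
apply: cvg_EFin; first by near=> n.
apply: nuD.
- by move=> k; exact: measurableI.
- exact: trivIset_setIr.
- by apply: bounded_sub bW => x [k _ []].
Unshelve. all: by end_near. Qed.

HB.instance Definition _ := isCharge.Build _ _ R rnu
  rnu0 rnu_fin rnu_sigma_additive.

End restriction.

Section integral.
Variables (W : set 'rV[R]_d) (mW : measurable W) (bW : bounded_set W).

(* Integral over W against a signed measure, through the Jordan decomposition
   of its restriction to W. *)
Definition signed_integral (nu : set 'rV[R]_d -> R)
    (nuD : locally_sigma_additive nu) (f : 'rV[R]_d -> R[i]) : R[i] :=
  let PN := cid (Hahn_decomposition (restr_charge nuD mW bW)) in
  let nuPN := projT2 (cid (projT2 PN)) in
  cintegral (jordan_pos nuPN) W f - cintegral (jordan_neg nuPN) W f.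

Definition cmeasure_integral (mu : cmeasure) (f : 'rV[R]_d -> R[i]) : R[i] :=
  signed_integral (@cmeasure_Re mu) f + 'i * signed_integral (@cmeasure_Im mu) f.

End integral.

End cmeasure.
Arguments cmeasure R d : clear implicits.

(* Main.v *)
(* Let psi(x) be the mu-measure of the part of Omega covered by the translates of x - A.
   It is the convolution of the periodized indicator of A with the image of mu|Omega on
   the torus, so by Fubini the integral against mu|Omega of the character e_n equals
   int psi e_n divided by the Fourier coefficient prod_k sin(pi a n_k) / (pi n_k) of A.
   The Diophantine condition bounds this coefficient below by a constant times
   prod_k (1 + |n_k|)^(-gamma). Cauchy-Schwarz and the orthonormality of the characters
   then give the inequality when f is a trigonometric polynomial.

   A general f is the uniform limit of its de la Vallee-Poussin means, whose Fourier
   coefficients are those of f multiplied by factors in [0, 1], so the right-hand side does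
   not increase. Working with these means, rather than with the Fourier series of f, also
   covers the case where the sum over n diverges. *)
Require Import Defs.
From mathcomp Require Import all_boot all_order all_algebra.
From mathcomp Require Import all_classical all_reals all_analysis.
From mathcomp Require Import measurable_realfun complex.
From mathcomp Require Import lra ring zify.

Set Implicit Arguments.
Unset Strict Implicit.
Unset Printing Implicit Defensive.

Import Order.TTheory GRing.Theory Num.Theory.
Import numFieldNormedType.Exports.

Local Open Scope classical_set_scope.
Local Open Scope ring_scope.

(** * Integration of bounded measurable complex functions *)

Section bounded_measurable.
Context d (T : measurableType d) (R : realType).
Implicit Types (f g : T -> R) (h k : T -> R[i]).

(** The constant is [(2 / delta) ^+ d], one factor per coordinate; the 2 comes from the elementary
    bound [x / 2 <= sin x] on [[0, pi / 2]]. All integrands are bounded and measurable and all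
    domains have finite measure. The class [bdm], with its complex version [cbdm], is closed under
    the algebraic operations used, so that integrability, linearity and Fubini come from membership
    in it. A complex measure enters only through four finite positive measures, the Jordan parts on
    [W] of its real and imaginary parts: each property of the integral is proved for a positive
    measure and then recombined. The kernel is a power of the cosine because its positivity, its
    mean and its first Fourier coefficient can be read off binomial coefficients; Korovkin's
    argument turns these facts into uniform convergence. Uniform convergence suffices since the
    measure has finite variation on the bounded set [W]. *)

Definition bdm f := measurable_fun setT f /\ exists M, forall x, `|f x| <= M.

Definition cbdm h := bdm (fun x => complex.Re (h x)) /\ bdm (fun x => complex.Im (h x)).

Lemma bdm_cst (c : R) : bdm (fun=> c).
Proof. by split; [exact: measurable_cst|exists `|c|]. Qed.

Lemma bdmD f g : bdm f -> bdm g -> bdm (fun x => f x + g x).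
Proof.
move=> [mf [M Mf]] [mg [N Ng]]; split; first exact: measurable_funD.
by exists (M + N) => x; rewrite (le_trans (ler_normD _ _))// lerD.
Qed.

Lemma bdmM f g : bdm f -> bdm g -> bdm (fun x => f x * g x).
Proof.
move=> [mf [M Mf]] [mg [N Ng]]; split; first exact: measurable_funM.
by exists (M * N) => x; rewrite normrM ler_pM.
Qed.

Lemma bdmN f : bdm f -> bdm (fun x => - f x).
Proof.
move=> bf; rewrite (_ : (fun _ => _) = fun x => -1 * f x).
  by apply: bdmM => //; exact: bdm_cst.
by apply/funext => x; rewrite mulN1r.
Qed.

Lemma bdmB f g : bdm f -> bdm g -> bdm (fun x => f x - g x).
Proof. by move=> bf bg; apply: bdmD => //; exact: bdmN. Qed.

Lemma bdm_indic (A : set T) : measurable A -> bdm \1_A.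
Proof.
move=> mA; split; first exact: measurable_indic.
by exists 1 => x; rewrite indicE ger0_norm ?ler0n// lern1; case: (_ \in _).
Qed.

Lemma cbdm_real f : bdm f -> cbdm (fun x => (f x)%:C%C).
Proof. by move=> bf; split => //=; exact: bdm_cst. Qed.

Lemma cbdm_cst (c : R[i]) : cbdm (fun=> c).
Proof. by split; exact: bdm_cst. Qed.

Lemma cReD (x y : R[i]) : complex.Re (x + y) = complex.Re x + complex.Re y.
Proof. by case: x; case: y. Qed.

Lemma cImD (x y : R[i]) : complex.Im (x + y) = complex.Im x + complex.Im y.
Proof. by case: x; case: y. Qed.

Lemma cReB (x y : R[i]) : complex.Re (x - y) = complex.Re x - complex.Re y.
Proof. by case: x; case: y. Qed.

Lemma cImB (x y : R[i]) : complex.Im (x - y) = complex.Im x - complex.Im y.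
Proof. by case: x; case: y. Qed.

Lemma cReM (x y : R[i]) : complex.Re (x * y) =
  complex.Re x * complex.Re y - complex.Im x * complex.Im y.
Proof. by case: x; case: y. Qed.

Lemma cImM (x y : R[i]) : complex.Im (x * y) =
  complex.Re x * complex.Im y + complex.Im x * complex.Re y.
Proof. by case: x; case: y. Qed.

Lemma cReJ (x : R[i]) : complex.Re x^*%C = complex.Re x.
Proof. by case: x. Qed.

Lemma cImJ (x : R[i]) : complex.Im x^*%C = - complex.Im x.
Proof. by case: x. Qed.

Lemma complexP (x y : R[i]) :
  complex.Re x = complex.Re y -> complex.Im x = complex.Im y -> x = y.
Proof. by case: x => a b; case: y => c e /= -> ->. Qed.

Lemma cbdmD h k : cbdm h -> cbdm k -> cbdm (fun x => h x + k x).
Proof.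
move=> [rh ih] [rk ik]; split.
  by under eq_fun do rewrite cReD; exact: bdmD.
by under eq_fun do rewrite cImD; exact: bdmD.
Qed.

Lemma cbdmM h k : cbdm h -> cbdm k -> cbdm (fun x => h x * k x).
Proof.
move=> [rh ih] [rk ik]; split.
  by under eq_fun do rewrite cReM; apply: bdmB; exact: bdmM.
by under eq_fun do rewrite cImM; apply: bdmD; exact: bdmM.
Qed.

Lemma cbdmJ h : cbdm h -> cbdm (fun x => (h x)^*%C).
Proof.
move=> [rh ih]; split; first by under eq_fun do rewrite cReJ.
by under eq_fun do rewrite cImJ; exact: bdmN.
Qed.

Lemma cbdm_sum (I : Type) (s : seq I) (P : pred I) (F : I -> T -> R[i]) :
  (forall i, cbdm (F i)) -> cbdm (fun x => \sum_(i <- s | P i) F i x).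
Proof.
move=> bF; elim: s => [|i s ih].
  by under eq_fun do rewrite big_nil; exact: cbdm_cst.
under eq_fun do rewrite big_cons.
by case: (P i) => //; exact: cbdmD.
Qed.

Lemma cbdm_prod (I : Type) (s : seq I) (P : pred I) (F : I -> T -> R[i]) :
  (forall i, cbdm (F i)) -> cbdm (fun x => \prod_(i <- s | P i) F i x).
Proof.
move=> bF; elim: s => [|i s ih].
  by under eq_fun do rewrite big_nil; exact: cbdm_cst.
under eq_fun do rewrite big_cons.
by case: (P i) => //; exact: cbdmM.
Qed.

End bounded_measurable.

Section bounded_measurable_comp.
Context d d' (T : measurableType d) (T' : measurableType d') (R : realType).

Lemma bdm_comp (p : T -> T') (f : T' -> R) :
  measurable_fun setT p -> bdm f -> bdm (fun x => f (p x)).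
Proof.
move=> mp [mf [M Mf]]; split; first exact: (measurableT_comp mf mp).
by exists M.
Qed.

Lemma cbdm_comp (p : T -> T') (h : T' -> R[i]) :
  measurable_fun setT p -> cbdm h -> cbdm (fun x => h (p x)).
Proof. by move=> mp [rh ih]; split; [exact: (bdm_comp mp rh)|exact: (bdm_comp mp ih)]. Qed.

End bounded_measurable_comp.

Section cint.
Context d (T : measurableType d) (R : realType).
Variable m : {measure set T -> \bar R}.

(** The formula of [cintegral] on an arbitrary measurable type, so that it serves on the line and on
    products as well; on row vectors the two are convertible. *)
Definition cint (D : set T) (h : T -> R[i]) : R[i] :=
  Complex (\int[m]_(x in D) complex.Re (h x)) (\int[m]_(x in D) complex.Im (h x)).

Variables (D : set T) (mD : measurable D) (Doo : (m D < +oo)%E).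
Implicit Types (f g : T -> R) (h k : T -> R[i]).

Lemma bdm_integrable f : bdm f -> m.-integrable D (EFin \o f).
Proof.
move=> [mf [M Mf]]; apply: measurable_bounded_integrable => //.
  exact: measurable_funTS.
exists M; split; first exact: num_real.
by move=> x Mx y _ /=; rewrite (le_trans (Mf _))// ltW.
Qed.

Lemma eq_cint h k : (forall x, D x -> h x = k x) -> cint D h = cint D k.
Proof.
by move=> hk; congr Complex; apply: eq_Rintegral => x; rewrite inE => /hk ->.
Qed.

Let intb := bdm_integrable.

Lemma cintD h k : cbdm h -> cbdm k ->
  cint D (fun x => h x + k x) = cint D h + cint D k.
Proof.
move=> [rh ih] [rk ik]; apply: complexP.
  rewrite cReD /= -(RintegralD mD (intb rh) (intb rk)).
  by apply: eq_Rintegral => x _; rewrite cReD.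
rewrite cImD /= -(RintegralD mD (intb ih) (intb ik)).
by apply: eq_Rintegral => x _; rewrite cImD.
Qed.

Lemma cintZ (c : R[i]) h : cbdm h -> cint D (fun x => c * h x) = c * cint D h.
Proof.
have cb (r : R) f : bdm f -> bdm (fun x => r * f x).
  by move=> bf; apply: bdmM => //; exact: bdm_cst.
move=> [rh ih]; apply: complexP.
  rewrite cReM /= -(RintegralZl _ mD (intb rh)) -(RintegralZl _ mD (intb ih)).
  rewrite -(RintegralB mD (intb (cb _ _ rh)) (intb (cb _ _ ih))).
  by apply: eq_Rintegral => x _; rewrite cReM.
rewrite cImM /= -(RintegralZl _ mD (intb rh)) -(RintegralZl _ mD (intb ih)).
rewrite -(RintegralD mD (intb (cb _ _ ih)) (intb (cb _ _ rh))).
by apply: eq_Rintegral => x _; rewrite cImM.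
Qed.

Lemma cint0 : cint D (fun=> 0) = 0.
Proof. by apply: complexP => /=; rewrite Rintegral_cst// mul0r. Qed.

Lemma cint_sum (I : Type) (s : seq I) (P : pred I) (F : I -> T -> R[i]) :
  (forall i, cbdm (F i)) ->
  cint D (fun x => \sum_(i <- s | P i) F i x) = \sum_(i <- s | P i) cint D (F i).
Proof.
move=> bF; elim: s => [|i s ih].
  rewrite big_nil -[RHS]cint0; apply: eq_cint => x _; exact: big_nil.
rewrite big_cons.
transitivity (cint D (fun x =>
    (if P i then F i x else 0) + \sum_(i <- s | P i) F i x)).
  by apply: eq_cint => x _; rewrite big_cons; case: (P i); rewrite ?add0r.
rewrite cintD//; last exact: cbdm_sum.
  by rewrite ih; case: (P i) => //; rewrite cint0 add0r.
by case: (P i) => //; exact: cbdm_cst.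
Qed.

Lemma le_Rint f g : bdm f -> bdm g -> (forall x, D x -> f x <= g x) ->
  \int[m]_(x in D) f x <= \int[m]_(x in D) g x.
Proof. by move=> bf bg; apply: le_Rintegral => //; exact: intb. Qed.

Lemma Rint_norm_le f (e : R) : bdm f -> (forall x, D x -> `|f x| <= e) ->
  `|\int[m]_(x in D) f x| <= e * fine (m D).
Proof.
move=> bf fe; rewrite -Rintegral_cst// ler_norml; apply/andP; split.
  rewrite lerNl -mulN1r -(RintegralZl _ mD (intb bf)).
  apply: le_Rint; [apply: bdmM => //; exact: bdm_cst|exact: bdm_cst|].
  by move=> x /fe; rewrite mulN1r ler_norml lerNl => /andP[].
apply: le_Rint => //; first exact: bdm_cst.
by move=> x /fe; rewrite ler_norml => /andP[].
Qed.

End cint.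

(** * Fubini on rectangles of finite measure *)

Section fubini.
Context d1 d2 (T1 : measurableType d1) (T2 : measurableType d2) (R : realType).
Variables (m1 : {sigma_finite_measure set T1 -> \bar R})
  (m2 : {sigma_finite_measure set T2 -> \bar R}).
Variables (D1 : set T1) (D2 : set T2).
Hypotheses (mD1 : measurable D1) (mD2 : measurable D2).
Hypotheses (D1oo : (m1 D1 < +oo)%E) (D2oo : (m2 D2 < +oo)%E).

Lemma bdm_pair1 (f : T1 * T2 -> R) x : bdm f -> bdm (fun y => f (x, y)).
Proof. by apply: bdm_comp; exact: pair1_measurable. Qed.

Lemma bdm_pair2 (f : T1 * T2 -> R) y : bdm f -> bdm (fun x => f (x, y)).
Proof. by apply: (@bdm_comp _ _ _ _ _ (fun x => (x, y))); exact: pair2_measurable. Qed.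

Lemma product_lt_pinfty : ((m1 \x m2)%E (D1 `*` D2) < +oo)%E.
Proof. by rewrite product_measure1E// lte_mul_pinfty// ge0_fin_numE. Qed.

(** Extension by zero outside the rectangle, which brings the integral to the whole product
    space. *)
Let integrable_restr (f : T1 * T2 -> R) : bdm f ->
  (m1 \x m2)%E.-integrable setT (EFin \o f \_ (D1 `*` D2)).
Proof.
move=> bf; rewrite -restrict_EFin.
apply/(integrable_mkcond (EFin \o f) (measurableX mD1 mD2)).
by apply: bdm_integrable => //; [exact: measurableX|exact: product_lt_pinfty].
Qed.

Lemma Rint_fubini1 (f : T1 * T2 -> R) : bdm f ->
  \int[m1]_(x in D1) \int[m2]_(y in D2) f (x, y) =
  \int[(m1 \x m2)%E]_(z in D1 `*` D2) f z.
Proof.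
move=> bf; rewrite Rintegral_mkcond [RHS]Rintegral_mkcond /Rintegral.
rewrite -(integral12_prod_meas1 (integrable_restr bf)); congr fine.
apply: eq_integral => x _; rewrite /fubini_F/= patchE; case: ifPn => [|/negbTE] xD1.
  (* The inner integral is finite, so [fine] preserves its value; it would send an infinite one to
     0. *)
  rewrite /Rintegral fineK.
    rewrite integral_mkcond; apply: eq_integral => y _.
    by rewrite !patchE in_setX xD1/=; case: ifP.
  apply: integrable_fin_num => //.
  by apply: bdm_integrable => //; exact: bdm_pair1.
by rewrite integral0_eq// => y _; rewrite patchE in_setX xD1.
Qed.

Lemma Rint_fubini2 (f : T1 * T2 -> R) : bdm f ->
  \int[m2]_(y in D2) \int[m1]_(x in D1) f (x, y) =
  \int[(m1 \x m2)%E]_(z in D1 `*` D2) f z.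
Proof.
move=> bf; rewrite Rintegral_mkcond [RHS]Rintegral_mkcond /Rintegral.
rewrite -(integral21_prod_meas1 (integrable_restr bf)); congr fine.
apply: eq_integral => y _; rewrite /fubini_G/= patchE; case: ifPn => [|/negbTE] yD2.
  rewrite /Rintegral fineK.
    rewrite integral_mkcond; apply: eq_integral => x _.
    by rewrite !patchE in_setX yD2 andbT/=; case: ifP.
  apply: integrable_fin_num => //.
  by apply: bdm_integrable => //; exact: bdm_pair2.
by rewrite integral0_eq// => x _; rewrite patchE in_setX yD2 andbF.
Qed.

Lemma cint_fubini1 (h : T1 * T2 -> R[i]) : cbdm h ->
  cint m1 D1 (fun x => cint m2 D2 (fun y => h (x, y))) =
  cint (m1 \x m2)%E (D1 `*` D2) h.
Proof. by move=> [rh ih]; congr Complex; rewrite -?(Rint_fubini1 rh) -?(Rint_fubini1 ih). Qed.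

Lemma cint_fubini (h : T1 * T2 -> R[i]) : cbdm h ->
  cint m1 D1 (fun x => cint m2 D2 (fun y => h (x, y))) =
  cint m2 D2 (fun y => cint m1 D1 (fun x => h (x, y))).
Proof.
move=> [rh ih]; rewrite cint_fubini1//; congr Complex.
  by rewrite -(Rint_fubini2 rh).
by rewrite -(Rint_fubini2 ih).
Qed.

End fubini.

(** * The unit interval and the unit cube *)

Section cube.
Context {R : realType}.
Notation lam := (@lebesgue_rV R).

Definition unit_itv : set R := `[0, 1[%classic.

Lemma unit_itvE (t : R) : unit_itv t = (0 <= t < 1) :> Prop.
Proof. by rewrite /unit_itv /= in_itv. Qed.

Lemma measurable_unit_itv : measurable unit_itv.
Proof. exact: measurable_itv. Qed.

Lemma lebesgue_unit_itv : lebesgue_measure unit_itv = 1%:E.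
Proof. by rewrite /unit_itv lebesgue_measure_itv /= lte01 oppr0 adde0. Qed.

Lemma unit_cubeS d : @consrV R d @^-1` unit_cube = unit_itv `*` unit_cube.
Proof.
apply/seteqP; split => [[t v] /= vc|[t v] [/= tc vc] i].
  split => /=; first by have := vc ord0; rewrite consrV0 unit_itvE.
  by move=> i; have := vc (lift ord0 i); rewrite consrVS.
case: (unliftP ord0 i) => [j|] ->; first by rewrite consrVS; exact: vc.
by rewrite consrV0/=; move: tc; rewrite unit_itvE.
Qed.

Lemma measurable_unit_cube d : measurable (@unit_cube R d).
Proof.
rewrite [X in measurable X](_ : _ = \bigcap_(i in [set: 'I_d])
    (setT `&` (fun v : 'rV[R]_d => v ord0 i) @^-1` unit_itv)).
  apply: fin_bigcap_measurable => [|i _]; first exact: finite_finset.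
  by apply: measurable_coord => //; exact: measurable_unit_itv.
apply/seteqP; split => v h i; first by move=> _; split => //=; rewrite unit_itvE; exact: h.
by have [] := h i Logic.I; rewrite /= unit_itvE.
Qed.

Lemma lebesgue_unit_cube d : lam d unit_cube = 1%:E.
Proof.
elim: d => [|d ih].
  by rewrite /= diracE mem_set// => -[].
change (lam d.+1 unit_cube) with ((lebesgue_measure \x lam d)%E (@consrV R d @^-1` unit_cube)).
rewrite unit_cubeS product_measure1E//; last exact: measurable_unit_cube.
  rewrite -[1%E](mule1 1%:E); congr (_ * _)%E; [exact: lebesgue_unit_itv|exact: ih].
exact: measurable_unit_itv.
Qed.

Lemma lebesgue_unit_cube_lt d : (lam d unit_cube < +oo)%E.
Proof. by rewrite lebesgue_unit_cube ltry. Qed.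

Lemma lebesgue_unit_itv_lt : (@lebesgue_measure R unit_itv < +oo)%E.
Proof. by rewrite lebesgue_unit_itv ltry. Qed.

Lemma cint_itvZ (c : R[i]) (h : R -> R[i]) (bh : cbdm h) :
  cint lebesgue_measure unit_itv (fun x => c * h x) = c * cint lebesgue_measure unit_itv h.
Proof. by apply: cintZ => //; [exact: measurable_unit_itv|exact: lebesgue_unit_itv_lt]. Qed.

Lemma cint_itv_sum (I : Type) (s : seq I) (P : pred I) (F : I -> R -> R[i])
    (bF : forall i, cbdm (F i)) :
  cint lebesgue_measure unit_itv (fun x => \sum_(i <- s | P i) F i x) =
  \sum_(i <- s | P i) cint lebesgue_measure unit_itv (F i).
Proof. by apply: cint_sum => //; [exact: measurable_unit_itv|exact: lebesgue_unit_itv_lt]. Qed.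

Lemma cint_cubeZ d (c : R[i]) (h : 'rV[R]_d -> R[i]) (bh : cbdm h) :
  cint (lam d) unit_cube (fun x => c * h x) = c * cint (lam d) unit_cube h.
Proof. by apply: cintZ => //; [exact: measurable_unit_cube|exact: lebesgue_unit_cube_lt]. Qed.

Lemma cint_cube_sum d (I : Type) (s : seq I) (P : pred I) (F : I -> 'rV[R]_d -> R[i])
    (bF : forall i, cbdm (F i)) :
  cint (lam d) unit_cube (fun x => \sum_(i <- s | P i) F i x) =
  \sum_(i <- s | P i) cint (lam d) unit_cube (F i).
Proof. by apply: cint_sum => //; [exact: measurable_unit_cube|exact: lebesgue_unit_cube_lt]. Qed.

(** The measure in dimension [d.+1] is the image of a product measure under [consrV]: a change of
    variables followed by Fubini. This is the step of the induction on the dimension. *)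
Lemma cint_cubeS d (h : 'rV[R]_d.+1 -> R[i]) : cbdm h ->
  cint (lam d.+1) unit_cube h =
  cint lebesgue_measure unit_itv (fun t => cint (lam d) unit_cube (fun v => h (consrV (t, v)))).
Proof.
move=> bh; have bhc : cbdm (fun p => h (consrV p)).
  by apply: cbdm_comp => //; exact: measurable_consrV.
rewrite (@cint_fubini1 _ _ _ _ R lebesgue_measure (lam d) unit_itv unit_cube
  measurable_unit_itv (@measurable_unit_cube d) lebesgue_unit_itv_lt
  (lebesgue_unit_cube_lt d) _ bhc).
have pf (f : 'rV[R]_d.+1 -> R) : bdm f -> \int[lam d.+1]_(x in unit_cube) f x =
   \int[(lebesgue_measure \x lam d)%E]_(x in unit_itv `*` unit_cube) f (consrV x).
  move=> bf; rewrite /Rintegral; congr fine.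
  rewrite -unit_cubeS.
  have := @integral_pushforward _ _ (measurableTypeR R * 'rV[R]_d)%type _ R _
    (@measurable_consrV R d) (lebesgue_measure \x lam d)%E unit_cube (EFin \o f).
  move=> /= -> //.
  - by apply/measurable_EFinP; case: bf.
  - rewrite unit_cubeS; apply: bdm_integrable.
    + by apply: measurableX; [exact: measurable_unit_itv|exact: measurable_unit_cube].
    + apply: product_lt_pinfty.
      * exact: measurable_unit_itv.
      * exact: measurable_unit_cube.
      * exact: lebesgue_unit_itv_lt.
      * exact: lebesgue_unit_cube_lt.
    + by apply: bdm_comp => //; exact: measurable_consrV.
  - exact: measurable_unit_cube.
by congr Complex; rewrite pf//; case: bh.
Qed.

Lemma cbdm_coord d (i : 'I_d) (g : R -> R[i]) :
  cbdm g -> cbdm (fun x : 'rV[R]_d => g (x ord0 i)).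
Proof. by apply: cbdm_comp; exact: measurable_coord. Qed.

(** Reduces to one dimension the orthogonality of characters, the Fourier coefficients of the box
    and the moments of the kernel. *)
Lemma cint_cube_prod d (g : 'I_d -> R -> R[i]) : (forall i, cbdm (g i)) ->
  cint (lam d) unit_cube (fun x => \prod_(i < d) g i (x ord0 i)) =
  \prod_(i < d) cint lebesgue_measure unit_itv (g i).
Proof.
elim: d g => [|d ih] g bg.
  (* In dimension 0 the cube is a single point of mass 1, and the empty product is 1. *)
  rewrite big_ord0; transitivity (cint (lam 0) unit_cube (fun=> 1%:C%C)).
    by apply: eq_cint => x _; rewrite big_ord0.
  have m0 := @measurable_unit_cube 0.
  apply: complexP; first by rewrite [LHS]Rintegral_cst// mul1r;
    exact: (congr1 fine (lebesgue_unit_cube 0)).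
  by rewrite [LHS]Rintegral_cst// mul0r.
rewrite cint_cubeS; last by apply: cbdm_prod => i; exact: cbdm_coord.
rewrite big_ord_recl -ih// mulrC -cint_itvZ//.
apply: eq_cint => t _; rewrite mulrC -cint_cubeZ.
  apply: eq_cint => v _; rewrite big_ord_recl consrV0; congr (_ * _).
  by apply: eq_bigr => i _; rewrite consrVS.
by apply: cbdm_prod => i; apply: cbdm_coord.
Qed.

End cube.

(** * One-dimensional characters *)

Section character.
Context {R : realType}.
Implicit Types (s t u v y : R) (n : int).

Lemma expi0 : expi 0 = 1 :> R[i].
Proof. by rewrite /expi cos0 sin0. Qed.

Lemma expiD s t : expi (s + t) = expi s * expi t.
Proof.
by apply: complexP; rewrite ?cReM ?cImM /= ?cosD// sinD addrC; congr (_ + _).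
Qed.

Lemma expiN t : expi (- t) = (expi t)^*%C.
Proof. by rewrite /expi cosN sinN. Qed.

Lemma normc_sqr (z : R[i]) :
  Normc.normc z ^+ 2 = complex.Re z ^+ 2 + complex.Im z ^+ 2.
Proof. by case: z => a b; rewrite /= sqr_sqrtr// addr_ge0// sqr_ge0. Qed.

Lemma normc_ge0 (z : R[i]) : 0 <= Normc.normc z.
Proof. by case: z => a b; rewrite sqrtr_ge0. Qed.

Lemma expi_sum (I : Type) (s : seq I) (P : pred I) (F : I -> R) :
  expi (\sum_(i <- s | P i) F i) = \prod_(i <- s | P i) expi (F i).
Proof. by apply: (big_morph _ expiD expi0). Qed.

Lemma expi_2piz n : expi (2 * pi * n%:~R) = 1 :> R[i].
Proof.
have e1 : expi (2 * pi) = 1 :> R[i].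
  by rewrite mulr_natl /expi cos2pi mulr2n sinD sinpi mul0r mulr0 addr0.
have en (k : nat) : expi (2 * pi * k%:R) = 1 :> R[i].
  elim: k => [|k ih]; first by rewrite mulr0 expi0.
  by rewrite -(addn1 k) natrD mulrDr expiD ih mulr1 e1 mulr1.
case: n => k; first exact: en.
by rewrite NegzE mulrNz mulrN expiN en conjc1.
Qed.

Definition ech n t : R[i] := expi (2 * pi * (n%:~R * t)).

Lemma echD n s t : ech n (s + t) = ech n s * ech n t.
Proof. by rewrite /ech -expiD -!mulrDr. Qed.

Lemma echDz n t (k : int) : ech n (t + k%:~R) = ech n t.
Proof.
have e : ech n k%:~R = 1 by rewrite /ech -intrM expi_2piz.
by rewrite echD e mulr1.
Qed.

Lemma ech_addl n k t : ech (n + k) t = ech n t * ech k t.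
Proof. by rewrite /ech -expiD -mulrDr -mulrDl intrD. Qed.

Lemma echN n t : ech n (- t) = (ech n t)^*%C.
Proof. by rewrite /ech -expiN !mulrN. Qed.

Lemma ech_oppl n t : ech (- n) t = (ech n t)^*%C.
Proof. by rewrite /ech -expiN mulrNz mulNr mulrN. Qed.

Lemma ech0 t : ech 0 t = 1.
Proof. by rewrite /ech mul0r mulr0 expi0. Qed.

Lemma ech_0 n : ech n 0 = 1.
Proof. by rewrite /ech !mulr0 expi0. Qed.

Lemma ech_1 n : ech n 1 = 1.
Proof. by rewrite /ech mulr1 expi_2piz. Qed.

Lemma bdm_cos d (T : measurableType d) (p : T -> R) :
  measurable_fun setT p -> bdm (fun x => cos (p x)).
Proof.
move=> mp; split; last by exists 1 => x; exact: cos_max.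
by apply: measurableT_comp mp; apply: continuous_measurable_fun; exact: continuous_cos.
Qed.

Lemma bdm_sin d (T : measurableType d) (p : T -> R) :
  measurable_fun setT p -> bdm (fun x => sin (p x)).
Proof.
move=> mp; split; last by exists 1 => x; exact: sin_max.
by apply: measurableT_comp mp; apply: continuous_measurable_fun; exact: continuous_sin.
Qed.

Lemma cbdm_expi d (T : measurableType d) (p : T -> R) :
  measurable_fun setT p -> cbdm (fun x => expi (p x)).
Proof. by move=> mp; split; [exact: bdm_cos|exact: bdm_sin]. Qed.

Lemma cbdm_ech n : cbdm (ech n).
Proof. by apply: cbdm_expi; do 2 apply: measurable_funM => //. Qed.

Lemma Rint_FTC (f F : R -> R) u v : (forall x : R, is_derive x 1 F (f x)) ->
  continuous f -> u <= v -> \int[lebesgue_measure]_(x in `[u, v]) f x = F v - F u.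
Proof.
move=> dF cf; rewrite le_eqVlt => /predU1P[->|uv].
  by rewrite set_itv1 Rintegral_set1 subrr.
have cF x : {for x, continuous F}.
  by apply: differentiable_continuous; apply/derivable1_diffP; have [] := dF x.
rewrite /Rintegral (continuous_FTC2 uv (F := F)) //.
- by apply: continuous_subspaceT => x; exact: cf.
- split; first by move=> x _; have [] := dF x.
  + by apply: cvg_at_right_filter; exact: cF.
  + by apply: cvg_at_left_filter; exact: cF.
- by move=> x _; rewrite derive1E derive_val.
Qed.

Lemma Rint_cos (w u v : R) : w != 0 -> u <= v ->
  \int[lebesgue_measure]_(x in `[u, v]) cos (w * x) = sin (w * v) / w - sin (w * u) / w.
Proof.
move=> w0; apply: (@Rint_FTC _ (fun x => sin (w * x) / w)) => [x|x].
  have -> : cos (w * x) = w^-1 *: (w *: (1:R) * cos (w * x)).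
    by rewrite /GRing.scale/= mulr1 mulKf.
  rewrite (_ : (fun _ => _) = (fun x => w^-1 *: sin (w * x))); last first.
    by apply/funext => y; rewrite mulrC.
  apply: is_deriveZ.
  have dw : is_derive x 1 (fun x : R => w * x) (w *: (1 : R)) by exact: is_deriveZ.
  rewrite mulrC; exact: (is_derive1_comp (is_derive_sin _) dw).
apply: (@continuous_comp _ _ _ (fun x : R => w * x) cos); last exact: continuous_cos.
exact: mulrl_continuous.
Qed.

Lemma Rint_sin (w u v : R) : w != 0 -> u <= v ->
  \int[lebesgue_measure]_(x in `[u, v]) sin (w * x) = - cos (w * v) / w + cos (w * u) / w.
Proof.
move=> w0; rewrite -[cos (w * u) / w]opprK -mulNr.
apply: (@Rint_FTC _ (fun x => - cos (w * x) / w)) => [x|x].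
  have -> : sin (w * x) = (- w^-1) *: (w *: (1:R) * (- sin (w * x))).
    by rewrite /GRing.scale/= mulr1 mulrN mulNr mulrN opprK mulKf.
  rewrite (_ : (fun _ => _) = (fun x => (- w^-1) *: cos (w * x))); last first.
    by apply/funext => y; rewrite /GRing.scale/= mulNr mulNr mulrC.
  apply: is_deriveZ.
  have dw : is_derive x 1 (fun x : R => w * x) (w *: (1 : R)) by exact: is_deriveZ.
  rewrite mulrC; exact: (is_derive1_comp (is_derive_cos _) dw).
apply: (@continuous_comp _ _ _ (fun x : R => w * x) sin); last exact: continuous_sin.
exact: mulrl_continuous.
Qed.

(** An antiderivative of [ech n]; for [n != 0] it is [ech n t / (2 pi i n)], with [1 / i] written as
    [- i]. *)
Definition echP n t : R[i] :=
  if n == 0 then t%:C%C else - 'i%C * ((2 * pi * n%:~R)^-1)%:C%C * ech n t.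

Lemma cint_ech n u v : u <= v ->
  cint lebesgue_measure `[u, v]%classic (ech n) = echP n v - echP n u.
Proof.
move=> uv; rewrite /echP; have [->|n0] := eqVneq n 0.
  have muv := @measurable_itv R `[u, v].
  have l : fine (lebesgue_measure (`[u, v]%classic : set R)) = v - u.
    rewrite lebesgue_measure_itv /= lte_fin; case: ltP => //=.
    by move=> vu; apply/eqP; rewrite eq_sym subr_eq0 eq_le uv vu.
  apply: complexP.
    transitivity (\int[@lebesgue_measure R]_(x in `[u, v]) (1 : R)).
      by apply: eq_Rintegral => x _; rewrite ech0.
    by rewrite Rintegral_cst// mul1r l.
  transitivity (\int[@lebesgue_measure R]_(x in `[u, v]) (0 : R)).
    by apply: eq_Rintegral => x _; rewrite ech0.
  by rewrite Rintegral_cst//= mul0r subrr.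
pose w : R := 2 * pi * n%:~R.
have w0 : w != 0 by rewrite !mulf_neq0 ?intr_eq0// gt_eqF ?pi_gt0.
have wE t : 2 * pi * (n%:~R * t) = w * t by rewrite mulrA.
apply: complexP; rewrite /= /ech -/w !wE.
  under eq_Rintegral do rewrite wE.
  by rewrite Rint_cos//; ring.
under eq_Rintegral do rewrite wE.
by rewrite Rint_sin//; ring.
Qed.

End character.

Section cint_set.
Context d (T : measurableType d) (R : realType) (m : {measure set T -> \bar R}).

Lemma cint_indic (D P : set T) (h : T -> R[i]) :
  cint m D (fun x => h x * (\1_P x)%:C%C) = cint m (D `&` P) h.
Proof.
by rewrite /cint; congr Complex; rewrite Rintegral_mkcondr; apply: eq_Rintegral => x _;
  rewrite ?cReM ?cImM patchE indicE; case: (x \in P); rewrite /= ?mulr1 ?mulr0 ?subr0 ?add0r.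
Qed.

Lemma cint_setU (A B : set T) (h : T -> R[i]) :
  measurable A -> measurable B -> (m A < +oo)%E -> (m B < +oo)%E ->
  A `&` B = set0 -> cbdm h -> cint m (A `|` B) h = cint m A h + cint m B h.
Proof.
move=> mA mB Aoo Boo AB [rh ih].
have dAB : [disjoint A & B] by apply/eqP.
have ABoo : (m (A `|` B) < +oo)%E.
  by rewrite measureU//; exact: lte_add_pinfty.
have mAB := measurableU _ _ mA mB.
apply: complexP; rewrite ?cReD ?cImD /=.
  exact: (Rintegral_setU mA mB (bdm_integrable mAB ABoo rh) dAB).
exact: (Rintegral_setU mA mB (bdm_integrable mAB ABoo ih) dAB).
Qed.

End cint_set.

(** * Fourier coefficients of a periodized interval *)

Section periodic_interval.
Context {R : realType}.
Implicit Types (a t y : R) (n : int).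

(* The 1-periodic extension of [-a/2, a/2]. *)
Definition pitv a : set R := [set t | exists m : int, `|t + m%:~R| <= a / 2].

Lemma measurable_pitv a : measurable (pitv a).
Proof.
rewrite [X in measurable X](_ : _ = \bigcup_(m in [set: int])
    `[- (a / 2) - m%:~R, a / 2 - m%:~R]%classic).
  by apply: countable_bigcupT_measurable => // m; exact: measurable_itv.
apply/seteqP; split => [t [m]|t [m _]] /=; rewrite ?in_itv/= => tm.
  by exists m => //=; rewrite in_itv/=; move: tm; rewrite ler_norml; lra.
by exists m; move: tm; rewrite ler_norml; lra.
Qed.

Lemma pitvDz a t (k : int) : pitv a (t + k%:~R) = pitv a t.
Proof.
apply/propext; split => -[m tm].
  by exists (k + m); rewrite intrD addrA.
exists (m - k); suff -> : t + k%:~R + (m - k)%:~R = t + m%:~R by [].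
by rewrite intrB; ring.
Qed.

(** For [0 < a < 1], the Fourier coefficient of the indicator of [pitv a] at frequency [n]; the
    value at 0 is the length of the interval. *)
Definition box_coef1 a n : R := if n == 0 then a else sin (pi * (n%:~R * a)) / (pi * n%:~R).

Lemma cint_ech_unit n : cint lebesgue_measure unit_itv (ech n) = (n == 0)%:R :> R[i].
Proof.
transitivity (cint (@lebesgue_measure R) `[0, 1]%classic (ech n)).
  have [br bi] := @cbdm_ech R n.
  by congr Complex; apply: Rintegral_itv_bndo_bndc; apply: bdm_integrable => //;
    rewrite -/unit_itv ?lebesgue_unit_itv_lt//; exact: measurable_unit_itv.
rewrite cint_ech// /echP; case: eqP => [_|_]; first by rewrite subr0.
by rewrite ech_0 ech_1 subrr.
Qed.

(** The antiderivative is periodic for [n != 0] and gains 1 per period for [n = 0]; the increment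
    over [[0, 1]] expresses both cases. It serves to join the two pieces of an interval that wraps
    around 1. *)
Lemma echPD1 n t : echP n (t + 1) = echP n t + (echP n 1 - echP n 0).
Proof.
rewrite /echP; case: eqP => [_|_]; first by rewrite subr0 -rmorphD.
by rewrite ech_1 ech_0 subrr addr0 (echDz _ _ 1).
Qed.

(** For [n != 0], the values of [ech n] at [a / 2] and [- a / 2] differ by [2 i sin (pi n a)], and
    the factor [- i / (2 pi n)] of [echP] turns this into [box_coef1 a n]. *)
Lemma echP_sub n a y : echP n (y + a / 2) - echP n (y - a / 2) =
  ech n y * (box_coef1 a n)%:C%C.
Proof.
rewrite /echP /box_coef1; case: eqP => [->|/eqP n0].
  by rewrite ech0 mul1r -rmorphB; congr (_%:C%C); field.
rewrite !echD echN -mulrBr -mulrBr [LHS]mulrCA; congr (_ * _).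
have pn : pi * n%:~R != 0 :> R by rewrite mulf_neq0 ?intr_eq0// gt_eqF ?pi_gt0.
have -> : ech n (a / 2) = expi (pi * (n%:~R * a)).
  by rewrite /ech; congr expi; field.
set w := pi * (_ * a).
have -> : (2 * pi * n%:~R)^-1 = 2^-1 * (pi * n%:~R)^-1 :> R by rewrite -invfM mulrA.
by rewrite /expi; set p := (pi * _)^-1; apply: complexP => /=; field.
Qed.

(* Modulo 1, [y] can be taken in [a/2, 1 + a/2); the interval around [y] then meets [0, 1)
   in one piece, or in two pieces of the same total length when it wraps around 1. *)
Lemma cint_pitv n a y : 0 < a < 1 ->
  cint lebesgue_measure unit_itv (fun t => ech n t * (\1_(pitv a) (t - y))%:C%C) =
  ech n y * (box_coef1 a n)%:C%C.
Proof.
move=> /andP[a0 a1].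
wlog ay : y / (a / 2 <= y < 1 + a / 2) => [wy|].
  pose k := - Num.floor (y - a / 2).
  have := wy (y + k%:~R); rewrite echDz => <-; last first.
    have fl := floor_le (y - a / 2); have := floorD1_gt (y - a / 2).
    rewrite /k mulrNz intrD => fg; lra.
  apply: eq_cint => t _; congr (_ * _%:C%C).
  rewrite !indicE; congr (_%:R); congr nat_of_bool; apply/idP/idP; rewrite !inE.
    by rewrite opprD addrA -mulrNz pitvDz.
  by rewrite opprD addrA -mulrNz pitvDz.
transitivity (cint lebesgue_measure (unit_itv `&` [set t | pitv a (t - y)]) (ech n)).
  rewrite -cint_indic; apply: eq_cint => t _; rewrite !indicE.
  by congr (_ * (_%:R)%:C%C); congr nat_of_bool; apply/idP/idP; rewrite !inE.
have itv_lt u v b c : (@lebesgue_measure R [set` Interval (BSide b u) (BSide c v)] < +oo)%E.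
  by rewrite lebesgue_measure_itv; case: ifP => _; rewrite ?ltry.
have [y1|y1] := ltP y (1 - a / 2).
  rewrite [X in cint _ X _](_ : _ = `[y - a / 2, y + a / 2]%classic); last first.
    apply/seteqP; split => t /=; rewrite unit_itvE in_itv/=.
      move=> [t01 [m]]; rewrite ler_norml => tm.
      have m0 : m = 0.
        have : (m%:~R < 1%:~R :> R) by lra.
        have : ((-1)%:~R < m%:~R :> R) by rewrite mulrNz; lra.
        by rewrite !ltr_int; lia.
      by move: tm; rewrite m0; lra.
    by move=> ty; split; [lra|exists 0; rewrite ler_norml; lra].
  rewrite cint_ech; last by lra.
  exact: echP_sub.
rewrite [X in cint _ X _](_ : _ =
    `[0, y + a / 2 - 1]%classic `|` `[y - a / 2, 1[%classic); last first.
  apply/seteqP; split => t /=; rewrite unit_itvE !in_itv/=.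
    move=> [t01 [m]]; rewrite ler_norml => tm.
    have m0 : m = 0 \/ m = 1.
      have : (m%:~R < 2%:~R :> R) by lra.
      have : ((-1)%:~R < m%:~R :> R) by rewrite mulrNz; lra.
      by rewrite !ltr_int; lia.
    by case: m0 tm => ->; [right|left]; lra.
  case => ty; split; try lra.
    by exists 1; rewrite ler_norml; lra.
  by exists 0; rewrite ler_norml; lra.
rewrite cint_setU//; [|exact: itv_lt|exact: itv_lt| |exact: cbdm_ech]; last first.
  by apply/seteqP; split => // t [] /=; rewrite !in_itv/=; lra.
rewrite cint_ech; last by lra.
have -> : cint (@lebesgue_measure R) `[y - a / 2, 1[%classic (ech n) =
    echP n 1 - echP n (y - a / 2).
  rewrite -cint_ech; last by lra.
  have [br bi] := @cbdm_ech R n.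
  by congr Complex; apply: Rintegral_itv_bndo_bndc; apply: bdm_integrable => //; exact: itv_lt.
(* The upper end [y + a / 2] lies one period beyond the end [y + a / 2 - 1] of the first piece. *)
rewrite -echP_sub -[y + a / 2 in RHS](subrK 1) echPD1.
by ring.
Qed.

End periodic_interval.

(** * Small divisors *)

Section small_divisors.
Context {R : realType}.
Implicit Types (a s x : R) (n : int).

(** With [u = x / 2], the mean value theorem gives [sin u = u cos c >= u cos u], hence
    [sin x = 2 sin u cos u >= 2 u (cos u)^2]; and [(cos u)^2 >= 1 / 2] because [u <= pi / 4]. *)
Lemma sin_ge_half x : 0 <= x <= pi / 2 -> x / 2 <= sin x.
Proof.
move=> /andP[x0 xpi]; have ppi := pi_gt0 R.
pose u := x / 2.
have [u0|u0] := leP u 0.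
  have -> : x = 0 by move: u0; rewrite /u; lra.
  by rewrite sin0 mul0r.
have [c cu su] : exists2 c, c \in `]0, u[ & sin u - sin 0 = cos c * (u - 0).
  apply: (@MVT _ sin cos) => //.
  by apply: continuous_subspaceT => y; exact: continuous_sin.
rewrite sin0 !subr0 in su.
move: cu; rewrite in_itv/= => /andP[c0 cu].
have upi : u <= pi / 4 by rewrite /u; lra.
have cuc : cos u <= cos c.
  by rewrite leNgt ltr_cos ?in_itv/= -?leNgt; lra.
have cu0 : 0 <= cos u by apply: cos_ge0_pihalf; lra.
have c2u : 0 <= cos (u + u) by apply: cos_ge0_pihalf; lra.
have := cos2Dsin2 u; move: c2u; rewrite cosD => c2u cs.
have -> : x = u + u by rewrite /u; lra.
rewrite sinD su; have : u * cos u ^+ 2 <= u * (cos u * cos c).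
  by rewrite ler_wpM2l ?(ltW u0)// expr2 ler_wpM2l.
have : u * 2^-1 <= u * cos u ^+ 2 by rewrite ler_wpM2l ?(ltW u0)//; nra.
by lra.
Qed.

(** It shows that the squared sine is 1-periodic, as [near_int] requires, and that it is a
    trigonometric polynomial of degree one, as [periodic_modulus] requires. *)
Lemma Re_ech1 s : complex.Re (ech 1 s) = 1 - 2 * sin (pi * s) ^+ 2.
Proof.
rewrite /ech /expi /= mul1r -mulrA mulr_natl mulr2n cosD.
by have := cos2Dsin2 (pi * s); lra.
Qed.

(** The witness is the nearest integer. After the shift by [h] the argument of the sine is at most
    [pi / 2] in absolute value, where [sin_ge_half] applies. *)
Lemma near_int s : exists2 h : int, `|s - h%:~R| <= 2^-1 &
  pi / 2 * `|s - h%:~R| <= `|sin (pi * s)|.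
Proof.
exists (Num.floor (s + 2^-1)); set h := Num.floor _.
  have := floor_le (s + 2^-1); have := floorD1_gt (s + 2^-1).
  by rewrite -/h intrD ler_norml; lra.
have ppi := pi_gt0 R.
have hs : `|s - h%:~R| <= 2^-1.
  have := floor_le (s + 2^-1); have := floorD1_gt (s + 2^-1).
  by rewrite -/h intrD ler_norml; lra.
set r := s - h%:~R in hs *.
(* The squares agree since [ech 1] takes the same value at [s] and [s - h]. *)
have -> : `|sin (pi * s)| = `|sin (pi * r)|.
  apply/eqP; rewrite -(@eqrXn2 _ 2)// !real_normK ?num_real//.
  have := Re_ech1 s; rewrite -(echDz _ _ (- h)) mulrNz -/r Re_ech1 => e.
  by apply/eqP; lra.
have -> : `|sin (pi * r)| = `|sin (pi * `|r|)|.
  by case: (ger0P r) => r0 //; rewrite mulrN sinN normrN.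
apply: le_trans (ler_norm _); rewrite mulrAC; apply: sin_ge_half.
by rewrite mulr_ge0 ?(ltW ppi)//= ler_pM2l.
Qed.

(** For [k = |n| >= 1] and [h] the integer given by [near_int] at [k a], the coefficient is at least
    [(pi / 2) |k a - h| / (pi k) = |a - h / k| / 2] in absolute value. The squared form is the one
    that multiplies over coordinates and compares with sums of squares. *)
Lemma box_coef1_bound a delta gamma : 0 < delta -> 0 <= gamma ->
  (forall (h : int) (k : nat), (1 <= k)%N ->
     delta * k%:R `^ (- gamma) <= `|a - h%:~R / k%:R|) ->
  forall n, 1 <= (2 / delta) ^+ 2 * (1 + `|n%:~R|) `^ (2 * gamma) * box_coef1 a n ^+ 2.
Proof.
move=> d0 g0 dioph n; have ppi := pi_gt0 R.
have p0 : 0 < 1 + `|n%:~R| :> R by rewrite ltr_wpDr.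
suff H : delta / 2 * (1 + `|n%:~R|) `^ (- gamma) <= `|box_coef1 a n|.
  have -> : (1 + `|n%:~R|) `^ (2 * gamma) = ((1 + `|n%:~R|) `^ (- gamma)) ^- 2.
    by rewrite powRN exprVn invrK -powR_mulrn ?powR_ge0// mulrC powRrM.
  have q0 : 0 < (1 + `|n%:~R|) `^ (- gamma) :> R by rewrite powR_gt0.
  move: H; set q := _ `^ _ in q0 * => H.
  rewrite -(real_normK (num_real (box_coef1 a n))) -exprVn -!exprMn exprn_ege1//.
  rewrite -ler_pdivrMl ?mulr1; last by rewrite mulr_gt0 ?invr_gt0// divr_gt0.
  by rewrite invfM invrK invf_div.
have [->|n0] := eqVneq n 0.
  (* For [n = 0] the hypothesis at [h / k = 0 / 1] reads [delta <= |a|]. *)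
  have := dioph 0 1%N isT; rewrite mul0r subr0 /box_coef1 eqxx normr0 addr0 !powR1.
  by rewrite !mulr1; lra.
pose k := `|n|%N.
have k1 : (1 <= k)%N by lia.
have k0 : 0 < k%:R :> R by rewrite ltr0n.
have nk : `|n%:~R| = k%:R :> R by rewrite -intr_norm natr_absz.
rewrite /box_coef1 (negbTE n0) normrM normfV normrM nk (ger0_norm (ltW ppi)).
have [h _ hs] := near_int (k%:R * a).
have -> : `|sin (pi * (n%:~R * a))| = `|sin (pi * (k%:R * a))|.
  rewrite -nk; case: (ger0P (n%:~R : R)) => // _.
  by rewrite mulNr mulrN sinN normrN.
rewrite ler_pdivlMr ?mulr_gt0//; apply: le_trans hs.
have -> : `|k%:R * a - h%:~R| = k%:R * `|a - h%:~R / k%:R|.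
  rewrite -{2}(ger0_norm (ltW k0)) -normrM; congr `|_|; field.
  by rewrite gt_eqF.
have qq : (1 + k%:R) `^ (- gamma) <= k%:R `^ (- gamma) :> R.
  have k10 : 0 < 1 + k%:R :> R by lra.
  by rewrite !powRN lef_pV2 ?posrE ?powR_gt0// ge0_ler_powR// ?nnegrE; lra.
have := dioph h k k1 => H.
have : delta * (1 + k%:R) `^ (- gamma) <= `|a - h%:~R / k%:R|.
  by apply: le_trans H; rewrite ler_wpM2l// ltW.
move=> H'; have : pi * k%:R * (delta * (1 + k%:R) `^ (- gamma)) <=
    pi * k%:R * `|a - h%:~R / k%:R| by rewrite ler_wpM2l// mulr_ge0 ?ltW.
by lra.
Qed.

End small_divisors.

(** * Fourier analysis on the torus *)

Section torus_characters.
Context {R : realType} {d : nat}.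
Notation lam := (@lebesgue_rV R d).
Implicit Types (n m : 'rV[int]_d) (x y : 'rV[R]_d) (a : R).

Definition chi n x : R[i] := \prod_(k < d) ech (n ord0 k) (x ord0 k).

Lemma cbdm_chi n : cbdm (chi n).
Proof. by apply: cbdm_prod => k; apply: cbdm_coord; exact: cbdm_ech. Qed.

Lemma chiD n m x : chi (n + m) x = chi n x * chi m x.
Proof. by rewrite /chi -big_split; apply: eq_bigr => k _; rewrite mxE ech_addl. Qed.

Lemma chiN n x : chi (- n) x = (chi n x)^*%C.
Proof. by rewrite /chi rmorph_prod; apply: eq_bigr => k _; rewrite mxE ech_oppl. Qed.

Lemma fourier_coefE (f : 'rV[R]_d -> R[i]) n :
  fourier_coef f n = cint lam unit_cube (fun x => f x * (chi n x)^*%C).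
Proof.
apply: eq_cint => x _; congr (_ * _); rewrite expiN; congr (_ ^*%C).
rewrite mulr_sumr expi_sum; apply: eq_bigr => k _.
by rewrite /ech mulrA.
Qed.

Lemma cint_chi n : cint lam unit_cube (chi n) = (n == 0)%:R.
Proof.
rewrite [LHS](cint_cube_prod (g := fun k => ech (n ord0 k))); last first.
  by move=> k; exact: cbdm_ech.
rewrite (eq_bigr _ (fun k _ => cint_ech_unit _)); case: eqP => [->|/eqP n0].
  by rewrite big1// => k _; rewrite mxE eqxx.
have /existsP[k nk] : [exists k, n ord0 k != 0].
  rewrite -negb_forall; apply: contra n0 => /forallP n0; apply/eqP/rowP => k.
  by rewrite mxE; exact/eqP.
by rewrite (bigD1 k)//= (negbTE nk) mul0r.
Qed.

Lemma chi_orthonormal n m :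
  cint lam unit_cube (fun x => chi n x * (chi m x)^*%C) = (n == m)%:R.
Proof.
rewrite -subr_eq0 -cint_chi; apply: eq_cint => x _.
by rewrite chiD chiN.
Qed.

Lemma chi_parseval (I : finType) (N : I -> 'rV[int]_d) (q : I -> R[i]) :
  injective N ->
  cint lam unit_cube (fun x => (\sum_i q i * chi (N i) x) * (\sum_i q i * chi (N i) x)^*%C) =
  \sum_i q i * (q i)^*%C.
Proof.
move=> Ninj.
transitivity (cint lam unit_cube (fun x => \sum_i \sum_j
    q i * (q j)^*%C * (chi (N i) x * (chi (N j) x)^*%C))).
  apply: eq_cint => x _; rewrite rmorph_sum mulr_suml; apply: eq_bigr => i _.
  rewrite mulr_sumr; apply: eq_bigr => j _.
  by rewrite rmorphM/= mulrACA.
have bij i j : cbdm (fun x => chi (N i) x * (chi (N j) x)^*%C).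
  by apply: cbdmM; [exact: cbdm_chi|apply: cbdmJ; exact: cbdm_chi].
have bqij i j : cbdm (fun x => q i * (q j)^*%C * (chi (N i) x * (chi (N j) x)^*%C)).
  by apply: cbdmM => //; exact: cbdm_cst.
rewrite cint_cube_sum; last by move=> i; exact: cbdm_sum.
apply: eq_bigr => i _; rewrite cint_cube_sum// (bigD1 i)//= cint_cubeZ//.
rewrite chi_orthonormal eqxx mulr1 big1 ?addr0// => j ji.
by rewrite cint_cubeZ// chi_orthonormal (inj_eq Ninj) eq_sym (negbTE ji) mulr0.
Qed.

(** The union of all integer translates of [x - box a], described by coordinates so that its
    indicator is a product. *)
Definition pbox a x : set 'rV[R]_d := [set y | forall k, pitv a (x ord0 k - y ord0 k)].

Definition box_coef a n : R := \prod_(k < d) box_coef1 a (n ord0 k).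

Lemma indic_pbox a x y :
  \1_(pbox a x) y = \prod_(k < d) \1_(pitv a) (x ord0 k - y ord0 k) :> R.
Proof.
rewrite indicE; case: (boolP (y \in _)) => [|yx].
  by rewrite inE => yx; rewrite big1// => k _; rewrite indicE mem_set//; exact: yx.
move: yx; rewrite notin_setE => /existsNP[k yk].
by rewrite (bigD1 k)//= indicE memNset// mul0r.
Qed.

(** Joint measurability in [x] and [y] is what Fubini requires; that of each section follows. *)
Lemma measurable_pbox2 a : measurable [set p : 'rV[R]_d * 'rV[R]_d | pbox a p.1 p.2].
Proof.
rewrite [X in measurable X](_ : _ = \bigcap_(k in [set: 'I_d])
    (setT `&` (fun p : 'rV[R]_d * 'rV[R]_d => p.1 ord0 k - p.2 ord0 k) @^-1` pitv a)).
  apply: fin_bigcap_measurable => [|k _]; first exact: finite_finset.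
  apply: measurable_funB => //; last exact: measurable_pitv.
    exact: (measurableT_comp (measurable_coord k) measurable_fst).
  exact: (measurableT_comp (measurable_coord k) measurable_snd).
apply/seteqP; split => p h k; first by move=> _; split => //=; exact: h.
by have [] := h k Logic.I.
Qed.

Lemma measurable_pbox a x : measurable (pbox a x).
Proof.
rewrite -[X in measurable X]setTI.
exact: (@pair1_measurable _ _ _ _ x measurableT _ (measurable_pbox2 a)).
Qed.

(** Characters are eigenfunctions of convolution with the box. Both sides factor over the
    coordinates, which reduces the identity to [cint_pitv]. *)
Lemma cint_pbox a n y : 0 < a < 1 ->
  cint lam unit_cube (fun x => chi n x * (\1_(pbox a x) y)%:C%C) =
  chi n y * (box_coef a n)%:C%C.
Proof.
move=> a01; pose g k t := ech (n ord0 k) t * (\1_(pitv a) (t - y ord0 k))%:C%C : R[i].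
transitivity (cint lam unit_cube (fun x => \prod_(k < d) g k (x ord0 k))).
  apply: eq_cint => x _; rewrite indic_pbox rmorph_prod -big_split.
  exact: eq_bigr.
rewrite (cint_cube_prod (g := g)).
  rewrite /box_coef rmorph_prod -big_split; apply: eq_bigr => k _.
  exact: cint_pitv.
move=> k; apply: cbdmM; first exact: cbdm_ech.
apply: cbdm_real; apply: (@bdm_comp _ _ _ _ _ (fun t : R => t - y ord0 k) (\1_(pitv a))).
  exact: measurable_funB.
by apply: bdm_indic; exact: measurable_pitv.
Qed.

Lemma box_coef_bound a delta gamma : 0 < delta -> 0 <= gamma ->
  (forall (h : int) (k : nat), (1 <= k)%N ->
     delta * k%:R `^ (- gamma) <= `|a - h%:~R / k%:R|) ->
  forall n, 1 <= ((2 / delta) ^+ d) ^+ 2 *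
    (\prod_(k < d) (1 + `|(n ord0 k)%:~R|) `^ (2 * gamma)) * box_coef a n ^+ 2.
Proof.
move=> d0 g0 dioph n.
have -> : ((2 / delta) ^+ d) ^+ 2 = \prod_(k < d) (2 / delta) ^+ 2.
  by rewrite prodr_const card_ord exprAC.
rewrite /box_coef -prodrXl -!big_split/=.
apply: (big_ind (fun z : R => 1 <= z)) => // [z t|k _]; first exact: mulr_ege1.
exact: box_coef1_bound.
Qed.

End torus_characters.

(** * Integration against a complex measure *)

Section functional.
Context {R : realType} {d : nat}.
Notation V := 'rV[R]_d.
Notation lam := (@lebesgue_rV R d).

Lemma fin_measure_lt (m : {finite_measure set V -> \bar R}) (A : set V) :
  measurable A -> (m A < +oo)%E.
Proof. by move=> mA; rewrite ltey_eq fin_num_measure. Qed.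

(** Hides the chosen Hahn decomposition: what follows uses only that two finite positive measures
    represent both [nu] and the integral. *)
Lemma signed_integralE (W : set V) (mW : measurable W) (bW : bounded_set W)
    (nu : set V -> R) (nuD : locally_sigma_additive nu) :
  exists P N : {finite_measure set V -> \bar R},
    (forall E, measurable E -> nu (E `&` W) = fine (P E) - fine (N E)) /\
    forall h, signed_integral mW bW nuD h = cint P W h - cint N W h.
Proof.
pose PN := cid (Hahn_decomposition (restr_charge nuD mW bW)).
pose nuPN := projT2 (cid (projT2 PN)).
exists (jordan_pos nuPN), (jordan_neg nuPN); split => [E mE|h]; last by [].
have /(congr1 fine) := jordan_decomp nuPN mE.
by rewrite /cadd/= cscaleN1 fineB//; apply: fin_num_measure.
Qed.

(** Measurable as the measure of a section of a jointly measurable set, and bounded by the mass of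
    [W]. *)
Lemma bdm_pbox_measure (m : {finite_measure set V -> \bar R}) (W : set V) (a : R) :
  measurable W -> bdm (fun x : V => fine (m (pbox a x `&` W))).
Proof.
move=> mW; split; last first.
  exists (fine (m W)) => x; rewrite ger0_norm ?fine_ge0//.
  apply: fine_le; rewrite ?fin_num_measure//.
    by apply: measurableI => //; exact: measurable_pbox.
  by apply: le_measure; rewrite ?inE//; apply: measurableI => //; exact: measurable_pbox.
apply: measurableT_comp => //.
have mA : measurable ([set p : V * V | pbox a p.1 p.2] `&` (setT `*` W)).
  by apply: measurableI; [exact: measurable_pbox2|exact: measurableX].
rewrite (_ : (fun _ => _) = m \o xsection ([set p : V * V | pbox a p.1 p.2] `&` (setT `*` W))).
  exact: measurable_fun_xsection.
apply/funext => x /=; congr (m _); apply/seteqP; split => y; rewrite xsectionE/= ?inE.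
  by move=> [].
by move=> [? []].
Qed.

Lemma cint_pbox_fubini (m : {finite_measure set V -> \bar R}) (W : set V) (a : R) (h : V -> R[i]) :
  measurable W -> cbdm h ->
  cint m W (fun y => cint lam unit_cube (fun x => h x * (\1_(pbox a x) y)%:C%C)) =
  cint lam unit_cube (fun x => h x * (fine (m (pbox a x `&` W)))%:C%C).
Proof.
move=> mW bh.
have b2 : cbdm (fun p : V * V => h p.1 * (\1_(pbox a p.1) p.2)%:C%C).
  apply: cbdmM; first by apply: (cbdm_comp measurable_fst).
  apply: cbdm_real.
  rewrite (_ : (fun _ => _) = \1_([set p : V * V | pbox a p.1 p.2])).
    by apply: bdm_indic; exact: measurable_pbox2.
  by apply/funext => p; rewrite !indicE; congr (_%:R); congr nat_of_bool.
have Woo := fin_measure_lt m mW.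
rewrite -(cint_fubini (@measurable_unit_cube R d) mW (@lebesgue_unit_cube_lt R d) Woo b2).
apply: eq_cint => x _ /=; rewrite cint_indic.
have mSW : measurable (W `&` pbox a x) by apply: measurableI => //; exact: measurable_pbox.
apply: complexP; rewrite /= Rintegral_cst// ?cReM ?cImM/=; rewrite setIC.
  by rewrite mulr0 subr0.
by rewrite mulr0 add0r.
Qed.

End functional.

Section cmeasure_functional.
Context {R : realType} {d : nat}.
Notation V := 'rV[R]_d.
Notation lam := (@lebesgue_rV R d).
Variables (W : set V) (mW : measurable W) (bW : bounded_set W).
Variable mu : cmeasure R d.
Notation L := (cmeasure_integral mW bW mu).

Lemma cmeasure_integralE : exists P1 N1 P2 N2 : {finite_measure set V -> \bar R},
  (forall E, measurable E -> mu (E `&` W) =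
     Complex (fine (P1 E) - fine (N1 E)) (fine (P2 E) - fine (N2 E))) /\
  forall h, L h = (cint P1 W h - cint N1 W h) + 'i%C * (cint P2 W h - cint N2 W h).
Proof.
have [P1 [N1 [mu1 L1]]] := signed_integralE mW bW (cmeasure_Re (c := mu)).
have [P2 [N2 [mu2 L2]]] := signed_integralE mW bW (cmeasure_Im (c := mu)).
exists P1, N1, P2, N2; split => [E mE|h].
  by apply: complexP; [exact: mu1|exact: mu2].
by rewrite /cmeasure_integral L1 L2.
Qed.

Lemma cmeasure_integralD (h k : V -> R[i]) : cbdm h -> cbdm k ->
  L (fun x => h x + k x) = L h + L k.
Proof.
have [P1 [N1 [P2 [N2 [_ LE]]]]] := cmeasure_integralE.
move=> bh bk; rewrite !LE !(cintD mW)//; try exact: fin_measure_lt.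
by ring.
Qed.

Lemma cmeasure_integralZ (c : R[i]) (h : V -> R[i]) : cbdm h ->
  L (fun x => c * h x) = c * L h.
Proof.
have [P1 [N1 [P2 [N2 [_ LE]]]]] := cmeasure_integralE.
move=> bh; rewrite !LE !(cintZ mW)//; try exact: fin_measure_lt.
by ring.
Qed.

Lemma cmeasure_integral_sum (I : finType) (q : I -> R[i]) (F : I -> V -> R[i]) :
  (forall i, cbdm (F i)) ->
  L (fun x => \sum_i q i * F i x) = \sum_i q i * L (F i).
Proof.
move=> bF; pose G i x := q i * F i x.
have bG i : cbdm (G i) by apply: cbdmM; [exact: cbdm_cst|].
have [P1 [N1 [P2 [N2 [_ LE]]]]] := cmeasure_integralE.
have key (m : {finite_measure set V -> \bar R}) :
    cint m W (fun x => \sum_i q i * F i x) = \sum_i cint m W (G i).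
  by apply: cint_sum => //; exact: fin_measure_lt.
rewrite LE !key.
rewrite -!sumrB mulr_sumr -big_split/=; apply: eq_bigr => i _.
by rewrite -cmeasure_integralZ// LE.
Qed.

(** Continuity for the uniform norm, which carries the inequality from the means to [f]. [C] is
    twice the total mass on [W] of the four positive measures; the 2 is a crude passage from real
    and imaginary parts to the modulus. *)
Lemma cmeasure_integral_bounded : exists2 C : R, 0 <= C &
  forall (h : V -> R[i]) (e : R), cbdm h -> 0 <= e ->
    (forall x, `|complex.Re (h x)| <= e /\ `|complex.Im (h x)| <= e) ->
    Normc.normc (L h) <= C * e.
Proof.
have [P1 [N1 [P2 [N2 [_ LE]]]]] := cmeasure_integralE.
have nb (m : {finite_measure set V -> \bar R}) h e : cbdm h ->
    (forall x, `|complex.Re (h x)| <= e /\ `|complex.Im (h x)| <= e) ->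
    Normc.normc (cint m W h) <= 2 * (fine (m W) * e).
  move=> [rh ih] he; have Woo := fin_measure_lt m mW.
  have /= r1 := Rint_norm_le mW Woo rh (fun x _ => proj1 (he x)).
  have /= i1 := Rint_norm_le mW Woo ih (fun x _ => proj2 (he x)).
  have := le_trans (normr_ge0 _) r1.
  set M := e * _ in r1 i1 * => M0.
  rewrite [fine _ * e]mulrC -/M.
  suff : Normc.normc (cint m W h) ^+ 2 <= (2 * M) ^+ 2.
    by rewrite ler_pXn2r// nnegrE ?normc_ge0// mulr_ge0.
  rewrite normc_sqr exprMn /=.
  have sq z : `|z| <= M -> z ^+ 2 <= M ^+ 2.
    by move=> zM; rewrite -(real_normK (num_real z)) ler_pXn2r// nnegrE.
  by have := sq _ r1; have := sq _ i1; have := sqr_ge0 M; lra.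
exists (2 * (fine (P1 W) + fine (N1 W) + fine (P2 W) + fine (N2 W))).
  by rewrite mulr_ge0// !addr_ge0// fine_ge0.
move=> h e bh e0 he; rewrite LE.
have i1 : Normc.normc 'i%C = 1 :> R by rewrite /= expr0n expr1n add0r sqrtr1.
apply: le_trans (le_normcD _ _) _.
rewrite Normc.normcM i1 mul1r.
have := nb P1 h e bh he; have := nb N1 h e bh he.
have := nb P2 h e bh he; have := nb N2 h e bh he.
have := le_normcD (cint P1 W h) (- cint N1 W h).
have := le_normcD (cint P2 W h) (- cint N2 W h).
rewrite !normcN; lra.
Qed.

Lemma cbdm_pbox (a : R) : cbdm (fun x => mu (pbox a x `&` W)).
Proof.
have [P1 [N1 [P2 [N2 [muE _]]]]] := cmeasure_integralE.
have bW' : forall x, pbox a x `&` W = pbox a x `&` W `&` W by move=> x; rewrite -setIA setIid.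
have mS x : measurable (pbox a x `&` W) by apply: measurableI => //; exact: measurable_pbox.
split; under eq_fun do rewrite bW' muE//=; apply: bdmB; exact: bdm_pbox_measure.
Qed.

Lemma cmeasure_integral_pbox (a : R) (h : V -> R[i]) : cbdm h ->
  L (fun y => cint lam unit_cube (fun x => h x * (\1_(pbox a x) y)%:C%C)) =
  cint lam unit_cube (fun x => h x * mu (pbox a x `&` W)).
Proof.
move=> bh; have [P1 [N1 [P2 [N2 [muE LE]]]]] := cmeasure_integralE.
rewrite LE !cint_pbox_fubini//.
have bm (m : {finite_measure set V -> \bar R}) :
    cbdm (fun x => h x * (fine (m (pbox a x `&` W)))%:C%C).
  by apply: cbdmM => //; apply: cbdm_real; exact: bdm_pbox_measure.
pose F (c : R[i]) (m : {finite_measure set V -> \bar R}) x :=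
  c * (h x * (fine (m (pbox a x `&` W)))%:C%C).
have bF c m : cbdm (F c m) by apply: cbdmM => //; exact: cbdm_cst.
transitivity (cint lam unit_cube (fun x =>
    (F 1 P1 x + F (-1) N1 x) + (F 'i%C P2 x + F (- 'i%C) N2 x))).
  rewrite !(cintD (@measurable_unit_cube R d) (@lebesgue_unit_cube_lt R d))//; try exact: cbdmD.
  by rewrite !cint_cubeZ//; ring.
apply: eq_cint => x _.
(* [muE] gives the values of [mu] on sets displayed as intersections with [W]. *)
have -> : pbox a x `&` W = pbox a x `&` W `&` W by rewrite -setIA setIid.
rewrite muE; last by apply: measurableI => //; exact: measurable_pbox.
rewrite /F; set p1 := fine (P1 _); set n1 := fine (N1 _).
set p2 := fine (P2 _); set n2 := fine (N2 _).
have -> : Complex (p1 - n1) (p2 - n2) = p1%:C%C - n1%:C%C + 'i%C * (p2%:C%C - n2%:C%C).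
  by apply: complexP => /=; ring.
by ring.
Qed.

Lemma cmeasure_fin_bigcup (I : choiceType) (D : set I) (F : I -> set V) :
  finite_set D -> trivIset D F -> (forall i, D i -> measurable (F i)) ->
  mu ((\bigcup_(i in D) F i) `&` W) = \sum_(i \in D) mu (F i `&` W).
Proof.
move=> fD tF mF; have [P1 [N1 [P2 [N2 [muE _]]]]] := cmeasure_integralE.
have fs (m : {finite_measure set V -> \bar R}) :
    fine (m (\bigcup_(i in D) F i)) = \sum_(i <- finmap.enum_fset (fset_set D)) fine (m (F i)).
  rewrite measure_fin_bigcup// fsbig_finite//= -[RHS]/(fine (_%:E)) -sumEFin.
  congr fine; apply: eq_big_seq => i; rewrite in_fset_set// inE => /mF mFi.
  by rewrite fineK// fin_num_measure.
rewrite muE; last exact: fin_bigcup_measurable.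
rewrite fsbig_finite//= !fs -!sumrB.
transitivity (\sum_(i <- finmap.enum_fset (fset_set D))
    (Complex (fine (P1 (F i)) - fine (N1 (F i))) (fine (P2 (F i)) - fine (N2 (F i))))).
  elim: (finmap.enum_fset (fset_set D)) => [|i s ih]; first by rewrite !big_nil.
  by rewrite !big_cons -ih.
by apply: eq_big_seq => i; rewrite in_fset_set// inE => /mF mFi; rewrite muE.
Qed.

End cmeasure_functional.

(** * Translates of the box *)

Section translates.
Context {R : realType} {d : nat}.
Notation V := 'rV[R]_d.
Implicit Types (a : R) (x y : V) (n : 'rV[int]_d).

Lemma coord_le_norm y (k : 'I_d) : `|y ord0 k| <= `|y|.
Proof.
rewrite [leRHS]/Num.norm /= mx_normrE; apply/bigmax_geP; right => /=.
by exists (ord0, k).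
Qed.

Lemma finite_int_box (K : nat) : finite_set [set n : 'rV[int]_d | forall k, `|n ord0 k| <= K%:Z].
Proof.
pose g (J : {ffun 'I_d -> 'I_(2 * K).+1}) : 'rV[int]_d := \row_k ((J k)%:Z - K%:Z).
apply: (@sub_finite_set _ _ (g @` setT)); last by apply: finite_image; exact: finite_finset.
move=> n /= nK; exists [ffun k => inord (absz (n ord0 k + K%:Z)%R)] => //.
apply/rowP => k; rewrite mxE ffunE; have := nK k; rewrite ler_norml => /andP[n1 n2].
move: (n ord0 k) n1 n2 => z n1 n2; rewrite inordK; lia.
Qed.

Definition translate a x n : set V := [set x + zrV n - y | y in box a].

Lemma translateE a x n :
  translate a x n = [set y | forall k, `|x ord0 k - y ord0 k + (n ord0 k)%:~R| <= a / 2].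
Proof.
apply/seteqP; split => [_ [z zA <-] k|y yA].
  by rewrite !mxE ler_norml; have := zA k; lra.
exists (x + zrV n - y); last by rewrite opprB addrC subrK.
by move=> k; rewrite !mxE; have := yA k; rewrite ler_norml; lra.
Qed.

Lemma measurable_translate a x n : measurable (translate a x n).
Proof.
rewrite translateE [X in measurable X](_ : _ = \bigcap_(k in [set: 'I_d])
    (setT `&` (fun y : V => y ord0 k) @^-1`
      `[x ord0 k + (n ord0 k)%:~R - a / 2, x ord0 k + (n ord0 k)%:~R + a / 2]%classic)).
  by apply: fin_bigcap_measurable => [|k _]; [exact: finite_finset|exact: measurable_coord].
apply/seteqP; split => y h k; last first.
  by have [_ /=] := h k Logic.I; rewrite in_itv/= ler_norml; lra.
by move=> _; split => //=; have := h k; rewrite in_itv/= ler_norml; lra.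
Qed.

(** A common point forces the two indices to differ by at most [a < 1] in each coordinate. *)
Lemma trivIset_translate a x : a < 1 -> trivIset setT (translate a x).
Proof.
move=> a1 n m _ _ [y []]; rewrite !translateE => yn ym; apply/rowP => k.
have := yn k; have := ym k; rewrite !ler_norml => hm hn.
have : ((n ord0 k - m ord0 k)%:~R < 1%:~R :> R) by rewrite intrB; lra.
have : ((m ord0 k - n ord0 k)%:~R < 1%:~R :> R) by rewrite intrB; lra.
by rewrite !ltr_int; move: (n ord0 k) (m ord0 k) => z t; lia.
Qed.

Lemma bigcup_translate a x : \bigcup_n translate a x n = pbox a x.
Proof.
apply/seteqP; split => [y [n _]|y xy].
  by rewrite translateE => yn k; exists (n ord0 k); exact: yn.
have [g gP] := boolp.choice xy; exists (\row_k g k) => //.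
by rewrite translateE => k; rewrite mxE.
Qed.

(** The sum over all integer vectors has finite support because [W] is bounded; with infinite
    support it would be 0 by convention. Since the translates are disjoint, finite additivity
    gathers the terms. *)
Lemma sum_translates (W : set V) (mW : measurable W) (bW : bounded_set W) (mu : cmeasure R d) a x :
  a < 1 ->
  \sum_(n \in [set: 'rV[int]_d]) mu (translate a x n `&` W) = mu (pbox a x `&` W).
Proof.
move=> a1; pose D := [set n | translate a x n `&` W !=set0].
have mu0 : mu set0 = 0.
  have := cmeasure_fin_bigcup mW bW mu (@finite_set0 'rV[int]_d) (F := fun=> set0).
  rewrite bigcup_set0 set0I fsbig_set0; apply => // i j [].
rewrite -(@fsbig_widen _ _ _ _ D)//; last first.
  move=> n [_ nD] /=; rewrite (_ : _ `&` _ = set0) ?mu0//.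
  by apply/eqP; apply: contra_notT nD => /set0P.
rewrite -(cmeasure_fin_bigcup mW bW)//.
- congr (mu _); apply/seteqP; split => y [].
    by move=> [n _ yn] Wy; split => //; rewrite -bigcup_translate; exists n.
  rewrite -bigcup_translate => -[n _ yn] Wy; split => //; exists n => //.
  by exists y.
(* If a point of [W] lies in the translate of index [n], every coordinate of [n] is at most [c] in
   absolute value. *)
- have [M [_ MW]] := bW.
  pose c : R := `|x| + `|M| + 1 + `|a|.
  apply: sub_finite_set (@finite_int_box (Num.bound c)) => n [y [yn Wy]] k.
  have y1 : `|y ord0 k| <= `|M| + 1.
    apply: le_trans (coord_le_norm y k) (MW _ _ _ Wy).
    by have := ler_norm M; lra.
  have x1 := coord_le_norm x k.
  have c0 : 0 <= c by rewrite /c !addr_ge0.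
  have := archi_boundP c0; move: yn; rewrite translateE => /(_ k) yn cb.
  rewrite -(ler_int R) intr_norm; apply: ltW; apply: le_lt_trans cb.
  have := ler_norm a; have := normr_ge0 a.
  move: yn y1 x1; rewrite /c !ler_norml.
  by set X := `|x|; set N := `|M|; set A := `|a|; lra.
- by apply: (sub_trivIset _ (@trivIset_translate a x a1)).
- by move=> n _; exact: measurable_translate.
Qed.

End translates.

(** * Approximation by de la Vallee-Poussin means *)

Section periodic_continuous.
Context {R : realType} {d : nat}.
Notation V := 'rV[R]_d.
Variable g : V -> R.
Hypotheses (cg : continuous g) (pg : Zperiodic g).

(** The closed cube is compact, unlike the half-open [unit_cube]. *)
Let Q : set V := [set v | forall i, v ord0 i \in `[0, 1]].

Let compactQ : compact Q.
Proof.
apply: (@rV_compact _ _ (fun=> `[(0 : R), 1]%classic)).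
by move=> _; apply: segment_compact.
Qed.

Lemma floor_shift (x : V) : exists n : 'rV[int]_d, Q (x + zrV n).
Proof.
exists (\row_k - Num.floor (x ord0 k)) => k; rewrite !mxE in_itv/= mulrNz.
have := floor_le (x ord0 k); have := floorD1_gt (x ord0 k).
by rewrite intrD; lra.
Qed.

(** Only [x] has to lie in [Q]: a pair of close points is moved by a single integer vector, which
    may leave [y] just outside. *)
Let unifQ (e : R) : 0 < e -> exists2 r : R, 0 < r &
  forall x y : V, Q x -> `|x - y| < r -> `|g x - g y| < e.
Proof.
move=> e0.
pose P (r : R) (x : V) := forall y, `|x - y| < r -> `|g x - g y| < e.
have /compact_near_coveringP/(_ R 0^'+ P) := compactQ.
have H : forall x, Q x -> \forall x' \near x & r \near 0^'+, P r x'.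
  move=> x _; have e2 : 0 < e / 2 by rewrite divr_gt0.
  have /cvgrPdist_lt/(_ _ e2) := @cg x.
  move=> /nbhs_ballP[r /= r0 rg]; have r2 : 0 < r / 2 by rewrite divr_gt0.
  (* Both [x'] and any [y] within [s < r / 2] of it lie in the ball of radius [r] around [x], on
     which [g] stays within [e / 2] of [g x]. *)
  exists (ball x (r / 2), [set s | 0 < s < r / 2]).
    split => /=; first exact: nbhsx_ballx.
    near=> s => /=; apply/andP; split; first by near: s; exact: nbhs_right_gt.
    by near: s; exact: nbhs_right_lt.
  move=> [x' s] /= [xx' /andP[s0 s2]] y x'y.
  rewrite (_ : g x' - g y = (g x - g y) - (g x - g x')); last by ring.
  apply: le_lt_trans (ler_normB _ _) _; rewrite [ltRHS]splitr.
  have xx'2 : `|x - x'| < r / 2 by move: xx'; rewrite -ball_normE.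
  apply: ltrD; apply: rg; rewrite -ball_normE /=.
    rewrite (_ : x - y = (x - x') + (x' - y)); last by rewrite addrA subrK.
    by apply: le_lt_trans (ler_normD _ _) _; lra.
  by apply: lt_trans xx'2 _; lra.
move=> /(_ _ H) K.
have : \forall r \near 0^'+, 0 < r /\ Q `<=` P r.
  near=> r; split; first by near: r; exact: nbhs_right_gt.
  by near: r.
move=> /(@filter_ex _ _ _)[r [r0 rP]]; exists r => // x y Qx; exact: rP.
Unshelve. all: by end_near. Qed.

Lemma periodic_bounded : exists2 M : R, 0 <= M & forall x, `|g x| <= M.
Proof.
have : compact (g @` Q).
  by apply: continuous_compact compactQ; apply: continuous_subspaceT => x; exact: cg.
move=> /compact_bounded[M [_ MP]]; exists (`|M| + 1) => [|x]; first by rewrite addr_ge0.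
have [n Qn] := floor_shift x; rewrite -(pg x n).
apply: (MP (`|M| + 1)); first by have := ler_norm M; lra.
by exists (x + zrV n).
Qed.

(* Korovkin-type modulus of continuity: it is integrated against a positive kernel
   of which only the mean and the first Fourier coefficient are known. *)
Lemma periodic_modulus (e : R) : 0 < e -> exists2 C : R, 0 <= C & forall x y : V,
  `|g x - g y| <= e + C * \sum_(k < d) (1 - complex.Re (ech 1 (x ord0 k - y ord0 k))).
Proof.
move=> e0; have [M M0 gM] := periodic_bounded.
have [r r0 rP] := unifQ e0.
(* If some coordinate of [x - y] stays [r] away from its integer, the corresponding term of the sum
   is at least [2 r^2]; this choice of [C] then gives at least [2 M], a trivial bound for the left
   side. *)
exists (M / r ^+ 2) => [|x y]; first by rewrite divr_ge0// sqr_ge0.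
pose F k := 1 - complex.Re (ech 1 (x ord0 k - y ord0 k)).
have FE k : F k = 2 * sin (pi * (x ord0 k - y ord0 k)) ^+ 2.
  by rewrite /F Re_ech1; ring.
have F0 k : 0 <= F k by rewrite FE mulr_ge0// sqr_ge0.
have S0 : 0 <= \sum_(k < d) F k by apply: sumr_ge0.
have Mr : 0 <= M / r ^+ 2 by rewrite divr_ge0// sqr_ge0.
have /boolp.choice[h hP] : forall k, exists h : int,
    pi / 2 * `|x ord0 k - y ord0 k - h%:~R| <= `|sin (pi * (x ord0 k - y ord0 k))|.
  by move=> k; have [h _ hk] := near_int (x ord0 k - y ord0 k); exists h.
(* A representative of [y] modulo integers for which each [|x_k - z_k|] is controlled by the
   sine. *)
pose z := y + zrV (\row_k h k).
have zk k : x ord0 k - z ord0 k = x ord0 k - y ord0 k - (h k)%:~R by rewrite !mxE; ring.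
have [n Qn] := floor_shift x.
case: (boolP [forall k, `|x ord0 k - z ord0 k| < r]) => [/forallP xz|].
  rewrite -(pg x n) -(pg y (\row_k h k)) -/z -(pg z n).
  suff /ltW : `|g (x + zrV n) - g (z + zrV n)| < e.
    by move=> H; apply: le_trans H _; rewrite lerDl mulr_ge0.
  apply: rP => //; rewrite opprD addrACA subrr addr0.
  rewrite [ltLHS]/Num.norm /= mx_normrE; apply/bigmax_ltP; split => // -[i k] _ /=.
  by rewrite ord1 !mxE; have := xz k; rewrite !mxE.
rewrite negb_forall => /existsP[k]; rewrite -leNgt zk => rk.
have hk := hP k.
have r1 : r <= `|sin (pi * (x ord0 k - y ord0 k))|.
  have := pi_ge2 R => p2.
  apply: le_trans hk; apply: le_trans rk _; rewrite ler_peMl//; lra.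
have r2 : 2 * r ^+ 2 <= F k.
  rewrite FE ler_pM2l// -(real_normK (num_real (sin _))) ler_pXn2r// nnegrE//.
  exact: ltW.
apply: (@le_trans _ _ (M / r ^+ 2 * (2 * r ^+ 2))).
  have -> : M / r ^+ 2 * (2 * r ^+ 2) = 2 * M by field; rewrite gt_eqF.
  by have := gM x; have := gM y; have := ler_normB (g x) (g y); lra.
apply: (@le_trans _ _ (M / r ^+ 2 * \sum_(k < d) F k)); last by rewrite lerDr ltW.
rewrite ler_wpM2l//; apply: le_trans r2 _.
by rewrite (bigD1 k)//= lerDl sumr_ge0.
Qed.

End periodic_continuous.

(** * The de la Vallee-Poussin kernel on the circle *)

Section kernel.
Context {R : realType}.
Implicit Types (N : nat) (s t : R).

(** Binomial coefficients increase up to the middle and are symmetric about it. Consequently the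
    multipliers [vp_coef] of the means are at most 1. *)
Lemma bin_le_central N j : ('C(N.*2, j) <= 'C(N.*2, N))%N.
Proof.
have up i : (i < N)%N -> ('C(N.*2, i) <= 'C(N.*2, i.+1))%N.
  move=> iN; have := mul_bin_left N.*2 i; have iN2 : (i.+1 <= N.*2 - i)%N by lia.
  by nia.
have le i : (i <= N)%N -> ('C(N.*2, i) <= 'C(N.*2, N))%N.
  move=> iN; rewrite -(subKn iN); elim: (N - i)%N => [|k ih]; first by rewrite subn0.
  case: (ltnP k N) => kN; last by rewrite (_ : N - k.+1 = N - k)%N//; lia.
  by apply: leq_trans ih; rewrite (_ : N - k = (N - k.+1).+1)%N; [apply: up|]; lia.
case: (leqP j N) => [/le//|Nj]; case: (leqP j N.*2) => [j2|/bin_small->//].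
by rewrite -bin_sub//; apply: le; lia.
Qed.

(** For [j] from 0 to [2 N], the Fourier coefficient of the kernel [vp N] at the frequency
    [N - j]. *)
Definition vp_coef N j : R := 'C(N.*2, j)%:R / 'C(N.*2, N)%:R.

Definition vp_freq N j : int := N%:Z - j%:Z.

Definition vp N t : R := (2 * cos (pi * t)) ^+ N.*2 / 'C(N.*2, N)%:R.

Lemma vp_coef_ge0 N j : 0 <= vp_coef N j.
Proof. by rewrite divr_ge0// ler0n. Qed.

Lemma central_gt0 N : 0 < 'C(N.*2, N)%:R :> R.
Proof. by rewrite ltr0n bin_gt0; lia. Qed.

Lemma vp_coef_le1 N j : vp_coef N j <= 1.
Proof. by rewrite ler_pdivrMr ?central_gt0// mul1r ler_nat bin_le_central. Qed.

Lemma vp_coefN N : vp_coef N N = 1.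
Proof. by rewrite /vp_coef divff// gt_eqF// central_gt0. Qed.

(** The index [N.+1] is the frequency -1, so this is the first Fourier coefficient of the kernel. *)
Lemma vp_coefS N : vp_coef N N.+1 = N%:R / N.+1%:R.
Proof.
have := mul_bin_left N.*2 N; rewrite (_ : N.*2 - N = N)%N; last by lia.
move=> /(congr1 (fun k => k%:R : R)); rewrite !natrM => e.
have c0 := central_gt0 N; have n0 : 0 < N.+1%:R :> R by rewrite ltr0n.
apply: (mulIf (lt0r_neq0 c0)); rewrite divfK ?gt_eqF//.
by apply: (mulfI (lt0r_neq0 n0)); rewrite e mulrA mulrCA divff ?gt_eqF// mulr1.
Qed.

Lemma vp_ge0 N t : 0 <= vp N t.
Proof. by rewrite divr_ge0// -mul2n exprM exprn_ge0// sqr_ge0. Qed.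

Lemma expiX t k : expi t ^+ k = expi (k%:R * t).
Proof.
elim: k => [|k ih]; first by rewrite mul0r expi0.
by rewrite exprS ih -expiD mulrSr mulrDl mul1r addrC.
Qed.

(* Binomial expansion of (e(t/2) + e(-t/2))^(2N). *)
Lemma vpE N t : (vp N t)%:C%C =
  \sum_(j < N.*2.+1) (vp_coef N j)%:C%C * ech (vp_freq N j) t.
Proof.
have -> : (vp N t)%:C%C = (expi (pi * t) + expi (- (pi * t))) ^+ N.*2 *
    (('C(N.*2, N)%:R)^-1 : R)%:C%C.
  rewrite (_ : expi _ + _ = (2 * cos (pi * t))%:C%C); last first.
    by rewrite expiN; apply: complexP => /=; ring.
  by rewrite -rmorphXn -rmorphM.
rewrite exprDn mulr_suml; apply: eq_bigr => j _.
have jN : (j <= N.*2)%N by rewrite -ltnS.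
rewrite !expiX -expiD /ech /vp_freq.
have -> : (N.*2 - j)%:R * (pi * t) + j%:R * - (pi * t) =
    2 * pi * ((N%:Z - j%:Z)%:~R * t).
  have N2 : N.*2%:R = N%:R * 2 :> R by rewrite -muln2 natrM.
  by rewrite intrB natrB// N2; ring.
rewrite /vp_coef rmorphM/= rmorph_nat -mulr_natl; ring.
Qed.

Lemma cbdm_vp N s : cbdm (fun t => (vp N (s - t))%:C%C).
Proof.
under eq_fun do rewrite vpE.
apply: cbdm_sum => j; apply: cbdmM; first exact: cbdm_cst.
by apply: (@cbdm_comp _ _ _ _ _ (fun t => s - t)); [exact: measurable_funB|exact: cbdm_ech].
Qed.

(** After expansion of the kernel, integration over a period keeps only the frequency [- n], whence
    a value independent of [s]. *)
Lemma cint_vp_ech N (n : int) s :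
  cint lebesgue_measure unit_itv (fun t => (vp N (s - t))%:C%C * ech n (s - t)) =
  \sum_(j < N.*2.+1) (vp_coef N j)%:C%C * (vp_freq N j + n == 0)%:R.
Proof.
have bF j : cbdm (fun t =>
    (vp_coef N j)%:C%C * ech (vp_freq N j + n) s * ech (- (vp_freq N j + n)) t).
  by apply: cbdmM; [exact: cbdm_cst|exact: cbdm_ech].
transitivity (cint lebesgue_measure unit_itv (fun t => \sum_(j < N.*2.+1)
    (vp_coef N j)%:C%C * ech (vp_freq N j + n) s * ech (- (vp_freq N j + n)) t)).
  apply: eq_cint => t _; rewrite vpE mulr_suml; apply: eq_bigr => j _.
  by rewrite -!mulrA -ech_addl echD echN ech_oppl.
rewrite cint_itv_sum//; apply: eq_bigr => j _.
rewrite cint_itvZ; last exact: cbdm_ech.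
by rewrite cint_ech_unit oppr_eq0 -mulrA; case: eqP => [->|_]; rewrite ?ech0 ?mul1r// !mulr0.
Qed.

Lemma cint_vp N s : cint lebesgue_measure unit_itv (fun t => (vp N (s - t))%:C%C) = 1.
Proof.
transitivity (cint lebesgue_measure unit_itv (fun t => (vp N (s - t))%:C%C * ech 0 (s - t))).
  by apply: eq_cint => t _; rewrite ech0 mulr1.
have jN : (N < N.*2.+1)%N by lia.
rewrite cint_vp_ech (bigD1 (Ordinal jN))//= big1 ?addr0 => [|j jne].
  by rewrite vp_coefN /vp_freq subrr eqxx mulr1.
rewrite addr0 /vp_freq subr_eq0 eqz_nat (_ : (N == j) = false) ?mulr0//.
by apply: contra_neqF jne => /eqP e; apply/val_inj.
Qed.

(** The mean 1 minus the first coefficient [N.+1 / N.+2]. Its decay gives the convergence of the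
    means. The order is [N.+1] because the frequency -1 does not occur in order 0. *)
Lemma cint_vp_defect N s : cint lebesgue_measure unit_itv
  (fun t => (vp N.+1 (s - t))%:C%C * (1 - ech 1 (s - t))) = ((N.+2%:R)^-1)%:C%C.
Proof.
have be : cbdm (fun t => (vp N.+1 (s - t))%:C%C * ech 1 (s - t)).
  apply: cbdmM; first exact: cbdm_vp.
  by apply: (@cbdm_comp _ _ _ _ _ (fun t => s - t)); [exact: measurable_funB|exact: cbdm_ech].
transitivity (cint lebesgue_measure unit_itv (fun t => (vp N.+1 (s - t))%:C%C +
    -1 * ((vp N.+1 (s - t))%:C%C * ech 1 (s - t)))).
  by apply: eq_cint => t _; ring.
have cD : cint lebesgue_measure unit_itv (fun t => (vp N.+1 (s - t))%:C%C +
    -1 * ((vp N.+1 (s - t))%:C%C * ech 1 (s - t))) =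
  cint lebesgue_measure unit_itv (fun t => (vp N.+1 (s - t))%:C%C) +
  cint lebesgue_measure unit_itv (fun t => -1 * ((vp N.+1 (s - t))%:C%C * ech 1 (s - t))).
  apply: cintD; [exact: measurable_unit_itv|exact: lebesgue_unit_itv_lt|exact: cbdm_vp|].
  by apply: cbdmM => //; exact: cbdm_cst.
rewrite cD cint_itvZ// cint_vp cint_vp_ech.
have jN : (N.+2 < N.+1.*2.+1)%N by lia.
rewrite (bigD1 (Ordinal jN))//= big1 ?addr0 => [|j jne]; last first.
  rewrite (_ : _ == 0 = false) ?mulr0//; apply: contra_neqF jne => /eqP.
  by rewrite /vp_freq => e; apply/val_inj => /=; lia.
rewrite (_ : _ == 0) ?mulr1; last by rewrite /vp_freq; lia.
rewrite vp_coefS mulN1r -[1]/(1%:C)%C -rmorphB; congr (_ %:C)%C.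
have n0 : 0 <= N%:R :> R by [].
by rewrite -!natr1; field; rewrite gt_eqF//; lra.
Qed.

End kernel.

(** * Means on the torus and their uniform convergence *)

Section approximation.
Context {R : realType} {d : nat}.
Notation V := 'rV[R]_d.
Notation lam := (@lebesgue_rV R d).
Implicit Types (x y : V) (N : nat).

Notation idx N := {ffun 'I_d -> 'I_N.*2.+1}.

Definition vpd_freq N (J : idx N) : 'rV[int]_d := \row_k vp_freq N (J k).

Definition vpd_coef N (J : idx N) : R := \prod_(k < d) vp_coef N (J k).

Definition vpd N x : R := \prod_(k < d) vp N (x ord0 k).

Lemma vpd_freq_inj N : injective (@vpd_freq N).
Proof.
move=> J K /rowP e; apply/ffunP => k; have := e k; rewrite !mxE /vp_freq => ek.
by apply/val_inj; move: ek => /addrI /oppr_inj [].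
Qed.

Lemma vpd_coef_sqr N (J : idx N) : vpd_coef J ^+ 2 <= 1.
Proof.
rewrite exprn_ile1// /vpd_coef; first by apply: prodr_ge0 => k _; exact: vp_coef_ge0.
by apply: prodr_ile1 => k _; rewrite vp_coef_ge0 vp_coef_le1.
Qed.

Lemma vpd_ge0 N x : 0 <= vpd N x.
Proof. by apply: prodr_ge0 => k _; exact: vp_ge0. Qed.

Lemma vpdE N x :
  (vpd N x)%:C%C = \sum_(J : idx N) (vpd_coef J)%:C%C * chi (vpd_freq J) x.
Proof.
rewrite /vpd rmorph_prod (eq_bigr _ (fun k _ => vpE _ _)) bigA_distr_bigA.
apply: eq_bigr => J _; rewrite /vpd_coef rmorph_prod /chi -big_split.
by apply: eq_bigr => k _; rewrite mxE.
Qed.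

Lemma chiB n x y : chi n (x - y) = chi n x * (chi n y)^*%C.
Proof.
rewrite /chi rmorph_prod -big_split; apply: eq_bigr => k _.
by rewrite !mxE echD echN.
Qed.

Lemma cbdm_shift (i : 'I_d) (h : R -> R[i]) x : cbdm h ->
  cbdm (fun y : V => h (x ord0 i - y ord0 i)).
Proof.
apply: (@cbdm_comp _ _ _ _ _ (fun y : V => x ord0 i - y ord0 i)).
by apply: measurable_funB => //; exact: measurable_coord.
Qed.

Lemma cbdm_1subech (n : int) : cbdm (fun u : R => 1 - ech n u).
Proof.
under eq_fun do rewrite -mulN1r.
apply: cbdmD; first exact: cbdm_cst.
by apply: cbdmM; [exact: cbdm_cst|exact: cbdm_ech].
Qed.

Lemma cbdm_vpd N x : cbdm (fun y => (vpd N (x - y))%:C%C).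
Proof.
under eq_fun do rewrite vpdE.
apply: cbdm_sum => J; apply: cbdmM; first exact: cbdm_cst.
under eq_fun do rewrite chiB.
by apply: cbdmM; [exact: cbdm_cst|apply: cbdmJ; exact: cbdm_chi].
Qed.

Lemma cint_vpd N x : cint lam unit_cube (fun y => (vpd N (x - y))%:C%C) = 1.
Proof.
transitivity (cint lam unit_cube (fun y => \prod_(k < d) (vp N (x ord0 k - y ord0 k))%:C%C)).
  apply: eq_cint => y _; rewrite /vpd rmorph_prod; apply: eq_bigr => k _.
  by rewrite !mxE.
rewrite (cint_cube_prod (g := fun k t => (vp N (x ord0 k - t))%:C%C)) => [|k].
  by rewrite big1// => k _; exact: cint_vp.
exact: cbdm_vp.
Qed.

(** The extra factor involves coordinate [k] alone; every other coordinate integrates to 1. *)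
Lemma cint_vpd_defect N x k : cint lam unit_cube
  (fun y => (vpd N.+1 (x - y))%:C%C * (1 - ech 1 (x ord0 k - y ord0 k))) =
  ((N.+2%:R)^-1)%:C%C.
Proof.
pose G i t : R[i] := (vp N.+1 (x ord0 i - t))%:C%C *
  (if i == k then 1 - ech 1 (x ord0 i - t) else 1).
transitivity (cint lam unit_cube (fun y => \prod_(i < d) G i (y ord0 i))).
  apply: eq_cint => y _; rewrite /G big_split /=; congr (_ * _).
    by rewrite /vpd rmorph_prod; apply: eq_bigr => i _; rewrite !mxE.
  rewrite (bigD1 k)//= eqxx big1 ?mulr1// => i /negbTE -> //.
have bG i : cbdm (G i).
  apply: cbdmM; first exact: cbdm_vp.
  case: eqP => _ /=; last exact: cbdm_cst.
  apply: (@cbdm_comp _ _ _ _ R (fun t : R => x ord0 i - t) _ _ (cbdm_1subech 1)).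
  exact: measurable_funB.
rewrite cint_cube_prod// (bigD1 k)//= big1 => [|i /negbTE ik]; last first.
  rewrite /G; transitivity (cint
    lebesgue_measure unit_itv (fun t => (vp N.+1 (x ord0 i - t))%:C%C)).
    by apply: eq_cint => t _; rewrite ik mulr1.
  exact: cint_vp.
rewrite mulr1 -(cint_vp_defect N (x ord0 k)); apply: eq_cint => t _.
by rewrite /G eqxx.
Qed.

(** Since the kernel has mean 1, the difference is the integral of [g y - g x] against it.
    Positivity allows the modulus of continuity to be integrated instead, and each coordinate
    contributes one defect [1 / N.+2]. *)
Lemma vpd_approx (g : V -> R) (e C : R) : bdm g -> 
  (forall x y, `|g x - g y| <=
     e + C * \sum_(k < d) (1 - complex.Re (ech 1 (x ord0 k - y ord0 k)))) ->
  forall N x, `|\int[lam]_(y in unit_cube) (g y * vpd N.+1 (x - y)) - g x| <=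
    e + C * d%:R / N.+2%:R.
Proof.
move=> bg gmod N x; have mQ := @measurable_unit_cube R d; have Qoo := @lebesgue_unit_cube_lt R d.
have bK := cbdm_vpd N.+1 x; have [rK _] := bK.
pose K y := vpd N.+1 (x - y).
pose E k y := (K y)%:C%C * (1 - ech 1 (x ord0 k - y ord0 k)).
have bE k : cbdm (E k).
  by apply: cbdmM => //; apply: (cbdm_shift k x (cbdm_1subech 1)).
(* The real part of [H] is the majorant; the complex form makes its integral computable from
   [cint_vpd_defect]. *)
pose H y := e%:C%C * (K y)%:C%C + C%:C%C * \sum_(k < d) E k y.
have bS : cbdm (fun y => \sum_(k < d) E k y) by exact: cbdm_sum.
have bH : cbdm H by apply: cbdmD; apply: cbdmM => //; exact: cbdm_cst.
have HE : cint lam unit_cube H = (e + C * d%:R / N.+2%:R)%:C%C.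
  rewrite (cintD mQ Qoo); [|by apply: cbdmM => //; exact: cbdm_cst..].
  rewrite !cint_cubeZ// cint_vpd mulr1 cint_cube_sum//.
  rewrite (eq_bigr _ (fun k _ => cint_vpd_defect N x k)).
  by rewrite sumr_const card_ord rmorphD -mulrA rmorphM -rmorphMn mulr_natl.
have ReH y : complex.Re (H y) =
    (e + C * \sum_(k < d) (1 - complex.Re (ech 1 (x ord0 k - y ord0 k)))) * K y.
  rewrite /H cReD !cReM /= mul0r subr0 mul0r subr0 mulrDl -mulrA; congr (_ + _ * _).
  rewrite mulr_suml (big_morph _ (@cReD R) (erefl _)); apply: eq_bigr => k _.
  by rewrite /E cReM /= mul0r subr0 mulrC.
have bd : bdm (fun y => (g y - g x) * K y).
  by apply: bdmM => //; apply: bdmB => //; exact: bdm_cst.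
have -> : \int[lam]_(y in unit_cube) (g y * vpd N.+1 (x - y)) - g x =
    \int[lam]_(y in unit_cube) ((g y - g x) * K y).
  have bc : bdm (fun _ : V => g x) by exact: bdm_cst.
  have b1 : bdm (fun y => g y * K y) by apply: bdmM.
  have b2 : bdm (fun y => g x * K y) by apply: bdmM.
  have K1 : \int[lam]_(y in unit_cube) K y = 1.
    by have /(congr1 (@complex.Re R)) := cint_vpd N.+1 x.
  rewrite -[X in _ - X](mulr1 (g x)) -K1.
  rewrite -(RintegralZl (g x) mQ (bdm_integrable mQ Qoo rK)).
  rewrite -(RintegralB mQ (bdm_integrable mQ Qoo b1) (bdm_integrable mQ Qoo b2)).
  by apply: eq_Rintegral => y _; rewrite mulrBl.
have HR : \int[lam]_(y in unit_cube) complex.Re (H y) = e + C * d%:R / N.+2%:R.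
  by have /(congr1 (@complex.Re R)) := HE.
have bRH : bdm (fun y => complex.Re (H y)) by case: bH.
have key y : `|(g y - g x) * K y| <= complex.Re (H y).
  rewrite ReH normrM (ger0_norm (vpd_ge0 _ _)) ler_wpM2r ?vpd_ge0//.
  by rewrite distrC; exact: gmod.
rewrite -HR ler_norml; apply/andP; split.
  have bN : bdm (fun y => -1 * complex.Re (H y)) by apply: bdmM => //; exact: bdm_cst.
  rewrite -mulN1r -(RintegralZl (-1) mQ (bdm_integrable mQ Qoo bRH)).
  apply: (le_Rint mQ Qoo) => // y _; rewrite mulN1r.
  by have := key y; rewrite ler_norml => /andP[].
by apply: (le_Rint mQ Qoo) => // y _; have := key y; rewrite ler_norml => /andP[].
Qed.

(** A trigonometric polynomial by definition, as [cmeasure_integral_trig_sqr] needs; [vp_meanE]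
    identifies it with the convolution that approximates [f]. *)
Definition vp_mean (f : V -> R[i]) N x : R[i] :=
  \sum_(J : idx N) (vpd_coef J)%:C%C * fourier_coef f (vpd_freq J) * chi (vpd_freq J) x.

Lemma vp_meanE (f : V -> R[i]) N x : cbdm f ->
  vp_mean f N x = cint lam unit_cube (fun y => f y * (vpd N (x - y))%:C%C).
Proof.
move=> bf; pose F (J : idx N) y :=
  ((vpd_coef J)%:C%C * chi (vpd_freq J) x) * (f y * (chi (vpd_freq J) y)^*%C).
have bfc (J : idx N) : cbdm (fun y => f y * (chi (vpd_freq J) y)^*%C).
  by apply: cbdmM => //; apply: cbdmJ; exact: cbdm_chi.
transitivity (cint lam unit_cube (fun y => \sum_J F J y)).
  rewrite cint_cube_sum => [|J]; last by apply: cbdmM => //; exact: cbdm_cst.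
  apply: eq_bigr => J _; rewrite /F cint_cubeZ//.
  by rewrite fourier_coefE mulrAC.
apply: eq_cint => y _; rewrite vpdE mulr_sumr; apply: eq_bigr => J _.
by rewrite /F chiB; ring.
Qed.

Lemma continuous_bdm (g : V -> R) : continuous g -> Zperiodic g -> bdm g.
Proof.
move=> cg pg; split.
  apply: (measurability _ (RGenOpens.measurableE R)).
  move=> _ [_ [u [v ->]] <-]; rewrite setTI; apply: open_measurable_rV.
  by apply: open_comp; [move=> w _; exact: cg|exact: interval_open].
by have [M _ gM] := periodic_bounded cg pg; exists M.
Qed.

Lemma csmooth_cbdm (f : V -> R[i]) : csmooth f -> Zperiodic f -> cbdm f.
Proof.
move=> [/(_ [::])[cr _] /(_ [::])[ci _]] pf.
by split; apply: continuous_bdm => // x n; rewrite /= pf.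
Qed.

Lemma vp_mean_cvg (f : V -> R[i]) (e : R) : csmooth f -> Zperiodic f -> 0 < e ->
  exists N, forall x, `|complex.Re (f x - vp_mean f N x)| <= e /\
    `|complex.Im (f x - vp_mean f N x)| <= e.
Proof.
move=> sf pf e0; have [br bi] := csmooth_cbdm sf pf.
have [/(_ [::])[cr _] /(_ [::])[ci _]] := sf.
have e2 : 0 < e / 2 by rewrite divr_gt0.
have pr : Zperiodic (fun x => complex.Re (f x)) by move=> x n; rewrite /= pf.
have pi : Zperiodic (fun x => complex.Im (f x)) by move=> x n; rewrite /= pf.
have [C C0 rC] := periodic_modulus cr pr e2.
have [C' C'0 iC] := periodic_modulus ci pi e2.
(* An order beyond [B] makes the error term at most [e / 2]; using [C + C'] gives one order for both
   the real and the imaginary part. *)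
pose B := (C + C') * d%:R / (e / 2).
have B0 : 0 <= B by rewrite divr_ge0 ?mulr_ge0 ?addr_ge0// ltW.
exists (Num.bound B).+1 => x; have := archi_boundP B0; set N := Num.bound B => BN.
have N2 : 0 < N.+2%:R :> R by rewrite ltr0n.
have small c : 0 <= c -> c <= C + C' -> e / 2 + c * d%:R / N.+2%:R <= e.
  move=> c0 cC; rewrite [leRHS]splitr lerD2l ler_pdivrMr//.
  have : (C + C') * d%:R <= e / 2 * N.+2%:R.
    rewrite mulrC [X in X <= _]mulrC [leRHS]mulrC -ler_pdivrMr//; apply: le_trans (ltW BN) _.
    by rewrite ler_nat; lia.
  by apply: le_trans; rewrite ler_wpM2r.
have fE : vp_mean f N.+1 x = cint lam unit_cube (fun y => f y * (vpd N.+1 (x - y))%:C%C).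
  by rewrite vp_meanE.
have bf : cbdm f by [].
split.
  have := le_trans (vpd_approx br rC N x) (small _ C0 _); rewrite lerDl => /(_ C'0).
  rewrite distrC cReB.
  rewrite fE; congr (`|_ - _| <= _); apply: eq_Rintegral => y _.
  by rewrite cReM /= mulr0 subr0.
have := le_trans (vpd_approx bi iC N x) (small _ C'0 _); rewrite lerDr => /(_ C0).
rewrite distrC cImB.
rewrite fE; congr (`|_ - _| <= _); apply: eq_Rintegral => y _.
by rewrite cImM /= mulr0 add0r.
Qed.

End approximation.

(** * The inequality for trigonometric polynomials *)

Section bessel.
Context {R : realType} {d : nat}.
Notation V := 'rV[R]_d.
Notation lam := (@lebesgue_rV R d).

Lemma bdm_normc_sqr (h : V -> R[i]) : cbdm h -> bdm (fun x => Normc.normc (h x) ^+ 2).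
Proof.
move=> [rh ih]; under eq_fun do rewrite normc_sqr !expr2.
by apply: bdmD; apply: bdmM.
Qed.

Lemma cint_cauchy_schwarz (D : set V) (m : {measure set V -> \bar R}) (q h : V -> R[i]) :
  measurable D -> (m D < +oo)%E -> cbdm q -> cbdm h ->
  Normc.normc (cint m D (fun x => q x * h x)) ^+ 2 <=
  (\int[m]_(x in D) (Normc.normc (q x) ^+ 2)) * (\int[m]_(x in D) (Normc.normc (h x) ^+ 2)).
Proof.
move=> mD Doo bq bh; set z := cint _ _ _; set A := Rintegral _ _ _; set B := Rintegral _ _ _.
have bqh := cbdmM bq bh.
have A0 : 0 <= A by apply: Rintegral_ge0 => x _; exact: sqr_ge0.
have B0 : 0 <= B by apply: Rintegral_ge0 => x _; exact: sqr_ge0.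
set t := Normc.normc z ^+ 2; have t0 : 0 <= t by exact: sqr_ge0.
(* The pointwise bound 2 Re(u v) <= |u|^2 + |v|^2 with u = s z^* q and v = h. *)
have key (s : R) : 2 * s * t <= s ^+ 2 * t * A + B.
  pose w : R[i] := (2 * s)%:C%C * z^*%C.
  have bw : cbdm (fun x => w * (q x * h x)) by apply: cbdmM => //; exact: cbdm_cst.
  have b1 : bdm (fun x => s ^+ 2 * t * Normc.normc (q x) ^+ 2).
    by apply: bdmM; [exact: bdm_cst|exact: bdm_normc_sqr].
  have b2 := bdm_normc_sqr bh.
  have -> : 2 * s * t = \int[m]_(x in D) complex.Re (w * (q x * h x)).
    rewrite -[RHS]/(complex.Re (cint m D (fun x => w * (q x * h x)))) (cintZ mD Doo)// -/z.
    by rewrite /t normc_sqr /w; case: (z) => u v /=; ring.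
  have -> : s ^+ 2 * t * A + B =
      \int[m]_(x in D) (s ^+ 2 * t * Normc.normc (q x) ^+ 2 + Normc.normc (h x) ^+ 2).
    rewrite (RintegralD mD (bdm_integrable mD Doo b1) (bdm_integrable mD Doo b2)).
    by rewrite (RintegralZl _ mD (bdm_integrable mD Doo (bdm_normc_sqr bq))).
  apply: (le_Rint mD Doo); [by case: bw|exact: bdmD|move=> x _].
  rewrite /t !normc_sqr /w; case: (z) (q x) (h x) => u v [a b] [e f] /=.
  have := sqr_ge0 (s * (u * a + v * b) - e); have := sqr_ge0 (s * (v * a - u * b) - f).
  have := sqr_ge0 (s * (u * b - v * a) - f); have := sqr_ge0 (s * (u * b - v * a) + f).
  nra.
have [A0'|Ane] := eqVneq A 0.
  (* If [A = 0] and [t > 0], the value [s = (B + 1) / (2 t)] would give [B + 1 <= B]. *)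
  rewrite A0' mul0r; have [//|tne] := leP t 0.
  have := key ((B + 1) / (2 * t)); rewrite A0' mulr0 add0r.
  rewrite (_ : 2 * _ * t = B + 1); last by field; rewrite gt_eqF.
  by lra.
have A1 : 0 < A by rewrite lt_def Ane.
(* The optimal [s = 1 / A] leaves [t / A <= B]. *)
have := key A^-1; have -> : A^-1 ^+ 2 * t * A = t / A by field.
rewrite (_ : 2 * A^-1 * t = t / A + t / A); last by field.
by rewrite lerD2l ler_pdivrMr// mulrC.
Qed.

Lemma le_sqrt_mul (x A B : R) : 0 <= x -> 0 <= A -> 0 <= B -> x ^+ 2 <= A * B ->
  x <= Num.sqrt A * Num.sqrt B.
Proof. by move=> x0 A0 B0 xAB; rewrite -sqrtrM// -(ger0_norm x0) -sqrtr_sqr ler_wsqrtr. Qed.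

Variables (W : set V) (mW : measurable W) (bW : bounded_set W) (mu : cmeasure R d).
Variables (a delta gamma : R).
Hypotheses (a01 : 0 < a < 1) (delta0 : 0 < delta) (gamma0 : 0 <= gamma).
Hypothesis dioph : forall (h : int) (k : nat), (1 <= k)%N ->
  delta * k%:R `^ (- gamma) <= `|a - h%:~R / k%:R|.

Let weight (n : 'rV[int]_d) : R := \prod_(k < d) (1 + `|(n ord0 k)%:~R|) `^ (2 * gamma).

Lemma weight_ge0 n : 0 <= weight n.
Proof. by apply: prodr_ge0 => k _; exact: powR_ge0. Qed.

(** Each coefficient is divided by that of the box, so that convolving [Q] with the periodized box
    restores the given polynomial. Parseval for [Q] then produces the squared divisors that
    [box_coef_bound] controls. *)
Lemma cmeasure_integral_trig_sqr (I : finType) (N : I -> 'rV[int]_d) (p : I -> R[i]) :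
  injective N ->
  Normc.normc (cmeasure_integral mW bW mu (fun x => \sum_i p i * chi (N i) x)) ^+ 2 <=
  ((2 / delta) ^+ d) ^+ 2 * (\sum_i weight (N i) * Normc.normc (p i) ^+ 2) *
  \int[lam]_(x in unit_cube) (Normc.normc (mu (pbox a x `&` W)) ^+ 2).
Proof.
move=> Ninj; pose b i : R[i] := (box_coef a (N i))%:C%C; pose q i := p i / b i.
have bnd i := box_coef_bound delta0 gamma0 dioph (N i).
have b2 i : 0 < box_coef a (N i) ^+ 2.
  (* A vanishing divisor would turn the lower bound into [1 <= 0]. *)
  rewrite lt_def sqr_ge0 andbT; apply: contraTneq (bnd i) => ->.
  by rewrite mulr0 -ltNge.
have b0 i : b i != 0.
  rewrite /b; apply: contraTneq (b2 i) => -[->].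
  by rewrite expr0n /= ltxx.
have cL i : cmeasure_integral mW bW mu (chi (N i)) =
    (b i)^-1 * cint lam unit_cube (fun x => chi (N i) x * mu (pbox a x `&` W)).
  apply: (mulfI (b0 i)); rewrite mulrA divff// mul1r.
  rewrite -(cmeasure_integral_pbox mW bW mu a (cbdm_chi (N i))).
  rewrite -cmeasure_integralZ; last exact: cbdm_chi.
  by congr cmeasure_integral; apply/funext => y; rewrite cint_pbox// mulrC.
pose Q x := \sum_i q i * chi (N i) x.
have bQ : cbdm Q.
  by apply: cbdm_sum => i; apply: cbdmM; [exact: cbdm_cst|exact: cbdm_chi].
have bpsi := cbdm_pbox mW bW mu a.
have bcp i : cbdm (fun x => chi (N i) x * mu (pbox a x `&` W)).
  by apply: cbdmM => //; exact: cbdm_chi.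
rewrite cmeasure_integral_sum; last by move=> i; exact: cbdm_chi.
have -> : \sum_i p i * cmeasure_integral mW bW mu (chi (N i)) =
    cint lam unit_cube (fun x => Q x * mu (pbox a x `&` W)).
  transitivity (cint lam unit_cube (fun x => \sum_i q i * (chi (N i) x * mu (pbox a x `&` W)))).
    rewrite cint_cube_sum; last by move=> i; apply: cbdmM => //; exact: cbdm_cst.
    by apply: eq_bigr => i _; rewrite cL cint_cubeZ// mulrA.
  by apply: eq_cint => x _; rewrite mulr_suml; apply: eq_bigr => i _; rewrite mulrA.
apply: le_trans (cint_cauchy_schwarz
  (@measurable_unit_cube R d) (@lebesgue_unit_cube_lt R d) bQ bpsi) _.
rewrite ler_wpM2r//; first by apply: Rintegral_ge0 => x _; exact: sqr_ge0.
have -> : \int[lam]_(x in unit_cube) (Normc.normc (Q x) ^+ 2) = \sum_i Normc.normc (q i) ^+ 2.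
  have /(congr1 (@complex.Re R)) := chi_parseval q Ninj.
  have sqE (u : R[i]) : complex.Re (u * u^*%C) = Normc.normc u ^+ 2.
    by rewrite normc_sqr; case: u => u v /=; ring.
  rewrite (big_morph _ (@cReD R) (erefl _)) (eq_bigr _ (fun i _ => sqE (q i))) => <-.
  by apply: eq_Rintegral => x _; rewrite -sqE.
rewrite mulr_sumr; apply: ler_sum => i _.
rewrite /q Normc.normcM Normc.normcV exprMn exprVn.
have -> : Normc.normc (b i) ^+ 2 = box_coef a (N i) ^+ 2.
  by rewrite normc_sqr /= expr0n addr0.
rewrite ler_pdivrMr//.
have := ler_wpM2l (sqr_ge0 (Normc.normc (p i))) (bnd i).
rewrite mulr1 /weight => H; apply: le_trans H _.
by rewrite le_eqVlt; apply/orP; left; apply/eqP; ring.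
Qed.

End bessel.

(** * The inequality for smooth functions *)

Theorem theorem8 (R : realType) (d : nat) (delta gamma : R) :
  (1 <= d)%N -> 0 < delta -> 2 <= gamma ->
  exists2 c : R, 0 < c &
  forall a : R, 0 < a < 1 -> irrational a ->
    (forall (h : int) (k : nat), (1 <= k)%N ->
       delta * k%:R `^ (- gamma) <= `|a - h%:~R / k%:R|) ->
  forall (W : set 'rV[R]_d) (mW : measurable W) (bW : bounded_set W)
    (mu : cmeasure R d) (f : 'rV[R]_d -> R[i]),
    Zperiodic_cmeasure mu -> Zperiodic f -> csmooth f ->
  ((Normc.normc (cmeasure_integral mW bW (conj_cmeasure mu) f))%:E <=
   c%:E *
   (\int[lebesgue_rV d]_(x in unit_cube)
      (Normc.normc (\sum_(n \in [set: 'rV[int]_d])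
        mu ([set x + zrV n - y | y in box a] `&` W)) ^+ 2)%:E) `^ 2^-1 *
   (\esum_(n in [set: 'rV[int]_d])
      ((\prod_(k < d) (1 + `|(n ord0 k)%:~R|) `^ (2 * gamma)) *
       Normc.normc (fourier_coef f n) ^+ 2)%:E) `^ 2^-1)%E.
Proof.
move=> _ delta0 gamma2; have gamma0 : 0 <= gamma by lra.
exists ((2 / delta) ^+ d); first by rewrite exprn_gt0// divr_gt0.
move=> a a01 _ dioph W mW bW mu f _ pf sf; have /andP[_ a1] := a01.
set c := (2 / delta) ^+ d; have c0 : 0 <= c by rewrite exprn_ge0// divr_ge0// ltW.
(* The argument runs with the conjugate measure; its value on each set has the same modulus as that
   of [mu], so the first factor on the right is unchanged. *)
pose nu := conj_cmeasure mu.
have nuE x : Normc.normc (\sum_(n \in [set: 'rV[int]_d])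
    mu ([set x + zrV n - y | y in box a] `&` W)) = Normc.normc (nu (pbox a x `&` W)).
  rewrite (sum_translates mW bW mu x a1) /nu /=.
  by case: (mu _) => u v; rewrite /= sqrrN.
pose A : R := \int[lebesgue_rV d]_(x in unit_cube) (Normc.normc (nu (pbox a x `&` W)) ^+ 2).
have A0 : 0 <= A by apply: Rintegral_ge0 => x _; exact: sqr_ge0.
rewrite [X in (_ <= _ * X `^ _ * _)%E](_ : _ = A%:E); last first.
  transitivity (\int[lebesgue_rV d]_(x in unit_cube)
      (Normc.normc (nu (pbox a x `&` W)) ^+ 2)%:E)%E.
    by apply: eq_integral => x _; rewrite nuE.
  rewrite /A /Rintegral fineK//; apply: integrable_fin_num; first exact: measurable_unit_cube.
  apply: bdm_integrable; [exact: measurable_unit_cube|exact: lebesgue_unit_cube_lt|].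
  by apply: bdm_normc_sqr; exact: (cbdm_pbox mW bW nu a).
set S := esum _ _; have S0 : (0 <= S)%E.
  by apply: esum_ge0 => n _; rewrite lee_fin mulr_ge0 ?sqr_ge0 ?weight_ge0.
have [C C0 nuC] := cmeasure_integral_bounded mW bW nu.
apply/lee_addgt0Pr => e e0.
(* The added 1 keeps the denominator positive when [C = 0]. *)
have e1 : 0 < e / (C + 1) by rewrite divr_gt0// ltr_wpDl.
have [N fN] := vp_mean_cvg sf pf e1.
pose P := vp_mean f N; have bf := csmooth_cbdm sf pf.
have bP : cbdm P.
  by apply: cbdm_sum => J; apply: cbdmM; [exact: cbdm_cst|exact: cbdm_chi].
have bfP : cbdm (fun x => f x - P x).
  under eq_fun do rewrite -mulN1r.
  by apply: cbdmD => //; apply: cbdmM => //; exact: cbdm_cst.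
have LfP : Normc.normc (cmeasure_integral mW bW nu f) <=
    Normc.normc (cmeasure_integral mW bW nu P) + e.
  rewrite (_ : f = fun x => P x + (f x - P x)); last by apply/funext => x; rewrite addrC subrK.
  rewrite cmeasure_integralD//; apply: le_trans (le_normcD _ _) _; rewrite lerD2l.
  apply: le_trans (nuC _ _ bfP (ltW e1) fN) _.
  by rewrite mulrA ler_pdivrMr ?ltr_wpDl// mulrC ler_pM2l// lerDl.
pose p J := (vpd_coef J : R)%:C%C * fourier_coef f (@vpd_freq d N J).
pose w (n : 'rV[int]_d) : R := \prod_(k < d) (1 + `|(n ord0 k)%:~R|) `^ (2 * gamma).
pose B := \sum_J w (@vpd_freq d N J) * Normc.normc (p J) ^+ 2.
have w0 n : 0 <= w n by exact: weight_ge0.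
have B0 : 0 <= B by apply: sumr_ge0 => J _; rewrite mulr_ge0// sqr_ge0.
(* [B] is at most a finite partial sum of [S]: the frequencies are distinct and the multipliers have
   square at most 1. No finiteness of [S] is involved. *)
have BS : (B%:E <= S)%E.
  apply: esum_ge; exists (range (@vpd_freq d N)).
    by split => //; apply: finite_image; exact: finite_finset.
  rewrite fsbig_image; last by move=> J K _ _; exact: vpd_freq_inj.
  rewrite (fsbig_fwiden (index_enum _)) ?index_enum_uniq//;
    [|by move=> J _ /=; rewrite mem_index_enum|by move=> J [_ nT]; case: nT].
  rewrite sumEFin lee_fin; apply: ler_sum => J _; rewrite ler_wpM2l// /p.
  rewrite Normc.normcM exprMn ler_piMl ?sqr_ge0//.
  by rewrite normc_sqr /= expr0n addr0 vpd_coef_sqr.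
have LP : Normc.normc (cmeasure_integral mW bW nu P) <= c * Num.sqrt A * Num.sqrt B.
  have := cmeasure_integral_trig_sqr mW bW nu a01 delta0 gamma0 dioph p (@vpd_freq_inj d N).
  rewrite -/A -/B -/c mulrC => H.
  have := le_sqrt_mul (normc_ge0 _) A0 (mulr_ge0 (sqr_ge0 c) B0) H.
  by rewrite sqrtrM ?sqr_ge0// sqrtr_sqr (ger0_norm c0) mulrCA mulrA.
apply: (@le_trans _ _ (c * Num.sqrt A * Num.sqrt B + e)%:E).
  by rewrite lee_fin; apply: le_trans LfP _; rewrite lerD2r.
rewrite EFinD leeD2r// poweR_EFin powR12_sqrt// !EFinM.
apply: lee_wpmul2l; first by rewrite -EFinM lee_fin mulr_ge0.
(* The comparison is made on extended real powers, whose monotonicity includes [S = +oo]. *)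
rewrite -powR12_sqrt// -poweR_EFin.
by rewrite gt0_ler_poweR ?invr_ge0// in_itv/= ?lee_fin ?leey ?andbT.
Qed.
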